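(* Let $0\le b_1\le b_2<\infty$ with $b_2>0$. The set $K(\mathrm{Ad}):=\bigcup_{B\in \mathrm{Ad}}K(B)$ is closed (in $\mathbb{C}$) and is a subset of $\mathbb{C}_+$.
   Context: $\mathrm{Ad}:=\{B\in L^\infty_{\mathbb{R}}(0,1): b_1\le B(x)\le b_2 \text{ for a.a. } x\in(0,1)\}$, and $\mathbb{C}_+=\{z\in\mathbb{C}:\operatorname{Im} z>0\}$. For $B\in L^\infty(0,1)$, a number $\kappa\in\mathbb{C}$, $\kappa\ne0$, is called a quasi-eigenvalue of $B$ if there is a nonzero solution $y\in W^{2,\infty}_{\mathbb{C}}[0,1]$ of $y''(x)+\kappa^2B(x)y(x)=0$ for a.a. $x\in(0,1)$ with $y'(0)=0$ and $y(1)-\mathrm{i}\,y'(1)/\kappa=0$. $K(B)$ denotes the set of all quasi-eigenvalues of $B$. *)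

(* Defs.v *)
From mathcomp Require Import all_boot all_order all_algebra.
From mathcomp Require Import all_classical all_reals all_analysis.
From mathcomp Require Import complex.

Set Implicit Arguments.
Unset Strict Implicit.
Unset Printing Implicit Defensive.

Import Order.TTheory GRing.Theory Num.Theory.
Import numFieldNormedType.Exports.

Local Open Scope classical_set_scope.
Local Open Scope ring_scope.
Local Open Scope complex_scope.

Definition I01 (R : realType) : set R := `]0, 1[%classic.
Arguments I01 {R}.

(* Elements of L^oo(0,1) are represented by functions on R, whose values
   outside (0,1) are irrelevant: the restriction of f to (0,1), extended by a
   constant, has to be measurable and essentially bounded. *)
Definition in_Linfty (R : realType) (f : R -> R) : Prop :=
  f \_ I01 \in Lfun (@lebesgue_measure R) +oo%E.

Definition ae01 (R : realType) (P : R -> Prop) : Prop :=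
  {ae @lebesgue_measure R, forall x, I01 x -> P x}.

(* phi belongs to C_c^oo(0,1) *)
Definition test_function (R : realType) (phi : R -> R) : Prop :=
  [/\ forall (n : nat) (x : R), derivable (derive1n n phi) x 1,
      compact (closure [set x | phi x != 0])
    & closure [set x | phi x != 0] `<=` I01].

(* v is a derivative of u on (0,1) in the sense of distributions. *)
Definition weak_derivative (R : realType) (u v : R -> R) : Prop :=
  forall phi : R -> R, test_function phi ->
    \int[@lebesgue_measure R]_(x in I01) (u x * derive1 phi x) =
    - \int[@lebesgue_measure R]_(x in I01) (v x * phi x).

(* u is in W^{1,oo}(0,1) with derivative v, and u is the representative of its
   class that is continuous on [0,1]. It is unique, so that the values of u at
   0 and at 1 make sense. The class of v is determined by that of u. *)
Definition W1oo (R : realType) (u v : R -> R) : Prop :=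
  [/\ in_Linfty u, in_Linfty v, weak_derivative u v
    & {within `[0, 1]%classic, continuous u}].

(* Complex-valued functions are handled componentwise. *)
Definition W1ooC (R : realType) (u v : R -> R[i]) : Prop :=
  W1oo (fun x => complex.Re (u x)) (fun x => complex.Re (v x)) /\
  W1oo (fun x => complex.Im (u x)) (fun x => complex.Im (v x)).

(* y is in W^{2,oo}[0,1] with y' = dy and y'' = d2y; y and dy are the
   continuous representatives, d2y is only determined almost everywhere. *)
Definition W2ooC (R : realType) (y dy d2y : R -> R[i]) : Prop :=
  W1ooC y dy /\ W1ooC dy d2y.

(* Since y is continuous on [0,1], being nonzero as an element of W^{2,oo} is
   the same as being nonzero at some point of [0,1]. *)
Definition quasi_eigenvalue (R : realType) (B : R -> R) (k : R[i]) : Prop :=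
  k != 0 /\
  exists y dy d2y : R -> R[i],
    [/\ W2ooC y dy d2y,
        exists2 x : R, `[0, 1]%classic x & y x != 0,
        ae01 (fun x => d2y x + k ^+ 2 * (B x)%:C * y x = 0),
        dy 0 = 0
      & y 1 - 'i%C * dy 1 / k = 0].

Definition K (R : realType) (B : R -> R) : set R[i] :=
  [set k | quasi_eigenvalue B k].

Definition Ad (R : realType) (b1 b2 : R) : set (R -> R) :=
  [set B | in_Linfty B /\ ae01 (fun x => b1 <= B x <= b2)].

Definition KAd (R : realType) (b1 b2 : R) : set R[i] :=
  \bigcup_(B in Ad b1 b2) K B.

Definition Cplus (R : realType) : set R[i] := [set z | 0 < complex.Im z].
Arguments Cplus {R}.

(* Main.v *)
Require Import Defs.
From HB Require Import structures.
From mathcomp Require Import all_boot all_order all_algebra.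
From mathcomp Require Import all_classical all_reals all_analysis.
From mathcomp Require Import measurable_realfun ess_sup_inf.
From mathcomp Require Import complex ring lra.
Set Implicit Arguments.
Unset Strict Implicit.
Unset Printing Implicit Defensive.
Import Order.TTheory GRing.Theory Num.Theory.
Import numFieldNormedType.Exports.
Local Open Scope classical_set_scope.
Local Open Scope ring_scope.
Local Open Scope complex_scope.

(** Write kappa = al + i be, y = p + i q and y' = r + i s, and let F be the
primitive of B that vanishes at 0. The proof works with a form of the problem
that contains no integral: F has slopes between b1 and b2, and over every
interval [a, b] the increments of y and y' agree with y'(a) (b - a) and
- kappa^2 y(a) (F b - F a) up to C (b - a)^2 ([string_sol]). Nothing is lost,
because a function with quadratically small increments is constant
([quad_constant]); and for a fixed C the conditions are stable under pointwise
limits.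

The upper half-plane. The real part h of - i conj(kappa) conj(y) y' satisfies
dh = - be (|y'|^2 dx + |kappa|^2 |y|^2 dF), and the boundary conditions give
h(0) = 0 and h(1) = - |kappa|^2 |y(1)|^2. If be <= 0, then h is nondecreasing,
hence y(1) = 0, hence y'(1) = 0, and y = 0 by a Gronwall argument
([string_sol_Im_gt0], [string_sol_unique]).

Closedness. After scaling, the maximum of |y| is 1. Then C depends only on b2
and on a bound for |kappa|, and |kappa| is bounded below ([string_int_sol]). Let
kappa tend, along an ultrafilter, to a point of the closure. All the functions
converge pointwise, and their limits solve the limit problem
([string_sol_limit]); the limit of y is not zero because the functions are
uniformly Lipschitz ([string_sol_limit_unit]). The limit of the primitives has
slopes between b1 and b2, and the Radon-Nikodym theorem turns it into the
primitive of an admissible coefficient ([slope_density]). This weak compactness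
of the set of admissible coefficients is the reason why the set of their
quasi-eigenvalues is closed.

Translation. A continuous function with a bounded weak derivative is the
integral of that derivative: this is seen by testing against smooth plateau
functions, built from exp(-1/(x (1 - x))), with shorter and shorter transitions
([W1oo_increment]). Conversely an integral of a bounded function has it as weak
derivative, by a product rule that follows from [quad_constant] again
([increment_W1oo]). *)

(** * Increments with a quadratic error *)

Definition bounded01 (R : realType) (f : R -> R) : Prop :=
  exists M : R, forall x : R, 0 <= x <= 1 -> `|f x| <= M.

(** The relation df = g0 dx + g1 dF, stated on increments with an error that is
quadratic in the length of the interval. The boundedness of f, g0 and g1 is
part of it because the product rule needs it. *)
Definition quad_diff (R : realType) (F f g0 g1 : R -> R) : Prop :=
  [/\ bounded01 f, bounded01 g0, bounded01 g1 &
    exists C : R, forall a b : R, 0 <= a -> a <= b -> b <= 1 ->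
      `|f b - f a - (g0 a * (b - a) + g1 a * (F b - F a))| <= C * (b - a) ^+ 2].

Section Bounded.
Variable R : realType.
Implicit Types f g : R -> R.

Lemma bounded01_cst (c : R) : bounded01 (fun=> c).
Proof. by exists `|c|. Qed.

Lemma bounded01P f : bounded01 f ->
  exists2 M : R, 0 <= M & forall x : R, 0 <= x <= 1 -> `|f x| <= M.
Proof.
move=> [M fM]; exists `|M| => // x x01.
exact: le_trans (fM x x01) (ler_norm _).
Qed.

Lemma bounded01D f g : bounded01 f -> bounded01 g ->
  bounded01 (fun x => f x + g x).
Proof.
move=> [M fM] [N gN]; exists (M + N) => x x01.
by rewrite (le_trans (ler_normD _ _))// lerD// ?fM// gN.
Qed.

Lemma bounded01M f g : bounded01 f -> bounded01 g ->
  bounded01 (fun x => f x * g x).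
Proof.
move=> /bounded01P[M M0 fM] /bounded01P[N N0 gN]; exists (M * N) => x x01.
by rewrite normrM ler_pM// ?fM// gN.
Qed.

End Bounded.

Section QuadraticIncrements.
Variable R : realType.

(** Cutting [a, b] into n equal pieces replaces the total error by
n * C ((b - a) / n)^2, which tends to 0. *)
Lemma quad_nondecreasing (f : R -> R) (C : R) :
  (forall a b : R, 0 <= a -> a <= b -> b <= 1 -> f a - C * (b - a) ^+ 2 <= f b) ->
  forall a b : R, 0 <= a -> a <= b -> b <= 1 -> f a <= f b.
Proof.
move=> H.
(* bisecting the interval halves the constant *)
have Hn n : forall a b : R, 0 <= a -> a <= b -> b <= 1 ->
    f a - C / 2 ^+ n * (b - a) ^+ 2 <= f b.
  elim: n => [|n IH] a b a0 ab b1; first by rewrite expr0 divr1; exact: H.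
  pose m := (a + b) / 2.
  have am : a <= m by rewrite /m; lra.
  have mb : m <= b by rewrite /m; lra.
  have h1 := IH a m a0 am (le_trans mb b1).
  have h2 := IH m b (le_trans a0 am) mb b1.
  have -> : C / 2 ^+ n.+1 * (b - a) ^+ 2 =
      C / 2 ^+ n * (m - a) ^+ 2 + C / 2 ^+ n * (b - m) ^+ 2.
    rewrite /m exprS; field; by rewrite expf_neq0.
  lra.
move=> a b a0 ab b1; apply/ler_addgt0Pr => e e0.
pose c := `|C| * (b - a) ^+ 2.
have c0 : 0 <= c by rewrite mulr_ge0// sqr_ge0.
have [n] : exists n : nat, c / e < n%:R.
  by exists (Num.bound (c / e)); rewrite archi_boundP// divr_ge0// ltW.
rewrite ltr_pdivrMr// => cn.
have n2 : n%:R <= (2 : R) ^+ n.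
  by rewrite -natrX ler_nat ltnW// ltn_expl.
have := Hn n a b a0 ab b1.
have : C / 2 ^+ n * (b - a) ^+ 2 <= e.
  rewrite mulrAC ler_pdivrMr ?exprn_gt0//.
  have : C * (b - a) ^+ 2 <= c by rewrite ler_wpM2r ?sqr_ge0// ler_norm.
  have : n%:R * e <= 2 ^+ n * e by rewrite ler_wpM2r// ltW.
  lra.
lra.
Qed.

(** This replaces integration throughout: two functions whose increments agree
up to a quadratic error differ by a constant. *)
Lemma quad_constant (f : R -> R) (C : R) :
  (forall a b : R, 0 <= a -> a <= b -> b <= 1 -> `|f b - f a| <= C * (b - a) ^+ 2) ->
  forall a b : R, 0 <= a -> a <= b -> b <= 1 -> f b = f a.
Proof.
move=> H a b a0 ab b1; apply/eqP; rewrite eq_le; apply/andP; split.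
  rewrite -lerN2; apply: (@quad_nondecreasing (fun x => - f x) C) => // x y x0 xy y1.
  by have := H x y x0 xy y1; rewrite ler_norml; lra.
apply: (@quad_nondecreasing f C) => // x y x0 xy y1.
by have := H x y x0 xy y1; rewrite ler_norml; lra.
Qed.

End QuadraticIncrements.

Section QuadDiff.
Variables (R : realType) (F : R -> R) (L : R).
Hypothesis F_slope : forall a b : R, 0 <= a -> a <= b -> b <= 1 ->
  0 <= F b - F a <= L * (b - a).

Lemma quad_diff_nondecreasing f g0 g1 : quad_diff F f g0 g1 ->
  (forall a b : R, 0 <= a -> a <= b -> b <= 1 ->
    0 <= g0 a * (b - a) + g1 a * (F b - F a)) ->
  forall a b : R, 0 <= a -> a <= b -> b <= 1 -> f a <= f b.
Proof.
move=> [_ _ _ [C HC]] H; apply: (@quad_nondecreasing _ f C) => a b a0 ab b1.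
by have := HC a b a0 ab b1; rewrite ler_norml; have := H a b a0 ab b1; lra.
Qed.

Lemma quad_diff_lipschitz f g0 g1 : quad_diff F f g0 g1 ->
  exists2 K : R, 0 <= K & forall a b : R, 0 <= a -> a <= b -> b <= 1 ->
    `|f b - f a| <= K * (b - a).
Proof.
move=> [_ /bounded01P[M0 M00 hM0] /bounded01P[M1 M10 hM1] [C HC]].
exists (M0 + M1 * `|L| + `|C|); first by rewrite !addr_ge0// mulr_ge0.
move=> a b a0 ab b1.
have a01 : 0 <= a <= 1 by rewrite a0 (le_trans ab).
have /andP[F0 F1] := F_slope a0 ab b1.
have ba : 0 <= b - a by rewrite subr_ge0.
rewrite -[X in `|X|](subrK (g0 a * (b - a) + g1 a * (F b - F a))).
rewrite (le_trans (ler_normD _ _))//.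
rewrite mulrDl addrC lerD//.
  rewrite (le_trans (ler_normD _ _))// mulrDl lerD//.
    by rewrite normrM (ger0_norm ba) ler_wpM2r// hM0.
  rewrite normrM -mulrA ler_pM// ?hM1// (ger0_norm F0) (le_trans F1)//.
  by rewrite ler_wpM2r// ler_norm.
rewrite (le_trans (HC a b a0 ab b1))//.
rewrite (@le_trans _ _ (`|C| * (b - a) ^+ 2))//.
  by rewrite ler_wpM2r// ?sqr_ge0// ler_norm.
by rewrite expr2 mulrA ler_piMr// ?mulr_ge0//; lra.
Qed.

Lemma quad_diffD f g0 g1 f' g0' g1' : quad_diff F f g0 g1 ->
  quad_diff F f' g0' g1' ->
  quad_diff F (fun x => f x + f' x) (fun x => g0 x + g0' x)
    (fun x => g1 x + g1' x).
Proof.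
move=> [bf b0 b1 [C HC]] [bf' b0' b1' [C' HC']].
split; try exact: bounded01D.
exists (C + C') => a b a0 ab b1_.
rewrite [leRHS]mulrDl; apply: le_trans _ (lerD (HC a b a0 ab b1_) (HC' a b a0 ab b1_)).
apply: le_trans _ (ler_normD _ _); rewrite le_eqVlt; apply/orP; left; apply/eqP.
by congr `|_|; ring.
Qed.

(** Product rule: the extra term is the product of two increments, each of them
linear in b - a because F is Lipschitz. *)
Lemma quad_diffM f g0 g1 f' g0' g1' : quad_diff F f g0 g1 ->
  quad_diff F f' g0' g1' ->
  quad_diff F (fun x => f x * f' x) (fun x => f x * g0' x + f' x * g0 x)
    (fun x => f x * g1' x + f' x * g1 x).
Proof.
move=> Hf Hf'.
have [K K0 HK] := quad_diff_lipschitz Hf.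
have [K' K0' HK'] := quad_diff_lipschitz Hf'.
move: Hf Hf' => [bf b0 b1 [C HC]] [bf' b0' b1' [C' HC']].
split; [exact: bounded01M|by apply: bounded01D; exact: bounded01M..|].
have [M M0 hM] := bounded01P bf; have [M' M0' hM'] := bounded01P bf'.
exists (M * C' + M' * C + K * K') => a b a0 ab b1_.
have a01 : 0 <= a <= 1 by rewrite a0 (le_trans ab).
have ba : 0 <= b - a by rewrite subr_ge0.
have -> : f b * f' b - f a * f' a - ((f a * g0' a + f' a * g0 a) * (b - a) +
     (f a * g1' a + f' a * g1 a) * (F b - F a)) =
   f a * (f' b - f' a - (g0' a * (b - a) + g1' a * (F b - F a))) +
   f' a * (f b - f a - (g0 a * (b - a) + g1 a * (F b - F a))) +
   (f b - f a) * (f' b - f' a) by ring.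
rewrite [leRHS]mulrDl [in leRHS]mulrDl (le_trans (ler_normD _ _))// lerD//.
  rewrite (le_trans (ler_normD _ _))// lerD// normrM -mulrA ler_pM//.
  - exact: hM.
  - exact: HC'.
  - exact: hM'.
  - exact: HC.
rewrite normrM expr2 mulrACA ler_pM//; [exact: HK|exact: HK'].
Qed.

Lemma quad_diff_cst (c : R) : quad_diff F (fun=> c) (fun=> 0) (fun=> 0).
Proof.
split; try exact: bounded01_cst.
by exists 0 => a b _ _ _; rewrite subrr !mul0r addr0 subr0 normr0.
Qed.

Lemma quad_diffZ (c : R) f g0 g1 : quad_diff F f g0 g1 ->
  quad_diff F (fun x => c * f x) (fun x => c * g0 x) (fun x => c * g1 x).
Proof.
move=> Hf; have := quad_diffM (quad_diff_cst c) Hf.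
by congr quad_diff; apply/funext => x; rewrite mulr0 addr0.
Qed.

(** Supplies the integrating factor of the Gronwall argument. The error is
controlled by exp u - 1 - u <= u^2 exp u for u >= 0. *)
Lemma quad_diff_expR (k : R) : 0 <= k ->
  quad_diff F (fun x => expR (k * x)) (fun x => k * expR (k * x)) (fun=> 0).
Proof.
move=> k0.
have bE : bounded01 (fun x => expR (k * x)).
  exists (expR k) => x /andP[x0 x1].
  by rewrite ger0_norm ?expR_ge0// ler_expR ler_piMr.
split=> //; [apply: bounded01M => //|..]; try exact: bounded01_cst.
exists (k ^+ 2 * expR k) => a b a0 ab b1.
pose u := k * (b - a).
have u0 : 0 <= u by rewrite mulr_ge0// subr_ge0.
have -> : expR (k * b) - expR (k * a) -
    (k * expR (k * a) * (b - a) + 0 * (F b - F a)) =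
    expR (k * a) * (expR u - 1 - u).
  have -> : k * b = k * a + u by rewrite /u; ring.
  by rewrite expRD /u; ring.
have e1 : 1 + u <= expR u by exact: expR_ge1Dx.
have e2 : expR u - 1 <= u * expR u.
  have := expR_ge1Dx (- u); rewrite expRN.
  have : expR u * (expR u)^-1 = 1 by rewrite divff// expR_eq0.
  have := expR_gt0 u; set e := expR u => egt0; set e' := e^-1 => ee' le'.
  have : e * (1 - u) <= e * e' by rewrite ler_wpM2l// ltW.
  lra.
have e3 : expR u - 1 - u <= u ^+ 2 * expR u.
  have : u * (expR u - 1) <= u * (u * expR u) by rewrite ler_wpM2l.
  by rewrite expr2; lra.
rewrite ger0_norm; last by rewrite mulr_ge0 ?expR_ge0//; lra.
rewrite (le_trans (ler_wpM2l (expR_ge0 _) e3))//.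
have -> : expR (k * a) * (u ^+ 2 * expR u) = k ^+ 2 * (b - a) ^+ 2 * expR (k * b).
  have -> : k * b = k * a + u by rewrite /u; ring.
  by rewrite expRD /u; ring.
rewrite mulrAC ler_wpM2r ?sqr_ge0// ler_wpM2l ?sqr_ge0//.
by rewrite ler_expR ler_piMr.
Qed.

End QuadDiff.

(** * The string equation without integrals *)

(** The equation y'' + kappa^2 B y = 0 for y = p + i q, y' = r + i s and
kappa = al + i be, where F is a primitive of B: the differentials are
dp = r dx, dq = s dx and dr + i ds = - kappa^2 y dF. No integral and no
regularity occurs, and a single constant C serves all estimates; hence these
conditions survive pointwise limits. The fields [ss_left] and [ss_right] are
the boundary conditions y'(0) = 0 and kappa y(1) = i y'(1). *)
Record string_sol (R : realType) (b1 b2 al be C : R) (F p q r s : R -> R) :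
    Prop := StringSol {
  ss_F : forall a b : R, 0 <= a -> a <= b -> b <= 1 ->
    b1 * (b - a) <= F b - F a <= b2 * (b - a);
  ss_p : forall a b : R, 0 <= a -> a <= b -> b <= 1 ->
    `|p b - p a - r a * (b - a)| <= C * (b - a) ^+ 2;
  ss_q : forall a b : R, 0 <= a -> a <= b -> b <= 1 ->
    `|q b - q a - s a * (b - a)| <= C * (b - a) ^+ 2;
  ss_r : forall a b : R, 0 <= a -> a <= b -> b <= 1 ->
    `|r b - r a + ((al ^+ 2 - be ^+ 2) * p a - 2 * al * be * q a) * (F b - F a)|
      <= C * (b - a) ^+ 2;
  ss_s : forall a b : R, 0 <= a -> a <= b -> b <= 1 ->
    `|s b - s a + (2 * al * be * p a + (al ^+ 2 - be ^+ 2) * q a) * (F b - F a)|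
      <= C * (b - a) ^+ 2;
  ss_bnd : forall x : R, 0 <= x <= 1 ->
    [/\ `|p x| <= C, `|q x| <= C, `|r x| <= C & `|s x| <= C];
  ss_left : r 0 = 0 /\ s 0 = 0;
  ss_right : al * p 1 - be * q 1 = - s 1 /\ al * q 1 + be * p 1 = r 1 }.

Section Uniqueness.
Variables (R : realType) (b1 b2 al be C : R) (F p q r s : R -> R).
Hypotheses (b1_ge0 : 0 <= b1) (b12 : b1 <= b2).
Hypothesis S : string_sol b1 b2 al be C F p q r s.

Let A := al ^+ 2 - be ^+ 2.
Let D := 2 * al * be.

Lemma string_sol_slope (a b : R) : 0 <= a -> a <= b -> b <= 1 ->
  0 <= F b - F a <= b2 * (b - a).
Proof.
move=> a0 ab lb1; have /andP[h ->] := ss_F S a0 ab lb1.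
by rewrite andbT (le_trans _ h)// mulr_ge0// subr_ge0.
Qed.

Local Notation F_slope := string_sol_slope.

Let bp : bounded01 p. Proof. by exists C => x /(ss_bnd S)[]. Qed.
Let bq : bounded01 q. Proof. by exists C => x /(ss_bnd S)[]. Qed.
Let br : bounded01 r. Proof. by exists C => x /(ss_bnd S)[]. Qed.
Let bs : bounded01 s. Proof. by exists C => x /(ss_bnd S)[]. Qed.

Lemma string_sol_diff_p : quad_diff F p r (fun=> 0).
Proof.
split=> //; first exact: bounded01_cst.
exists C => a b a0 ab lb1; rewrite mul0r addr0.
exact: (ss_p S).
Qed.

Lemma string_sol_diff_q : quad_diff F q s (fun=> 0).
Proof.
split=> //; first exact: bounded01_cst.
by exists C => a b a0 ab lb1; rewrite mul0r addr0; exact: (ss_q S).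
Qed.

Lemma string_sol_diff_r : quad_diff F r (fun=> 0)
  (fun x => - (al ^+ 2 - be ^+ 2) * p x + 2 * al * be * q x).
Proof.
split=> //; first exact: bounded01_cst.
  by apply: bounded01D; apply: bounded01M => //; exact: bounded01_cst.
exists C => a b a0 ab lb1; rewrite (le_trans _ (ss_r S a0 ab lb1))//.
by rewrite le_eqVlt; apply/orP; left; apply/eqP; congr `|_|; ring.
Qed.

Lemma string_sol_diff_s : quad_diff F s (fun=> 0)
  (fun x => - (2 * al * be) * p x + - (al ^+ 2 - be ^+ 2) * q x).
Proof.
split=> //; first exact: bounded01_cst.
  by apply: bounded01D; apply: bounded01M => //; exact: bounded01_cst.
exists C => a b a0 ab lb1; rewrite (le_trans _ (ss_s S a0 ab lb1))//.
by rewrite le_eqVlt; apply/orP; left; apply/eqP; congr `|_|; ring.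
Qed.

Local Notation dp := string_sol_diff_p.
Local Notation dq := string_sol_diff_q.
Local Notation dr := string_sol_diff_r.
Local Notation ds := string_sol_diff_s.

(** Gronwall: by the right boundary condition y'(1) = 0 as well, and the energy
E = |y|^2 + |y'|^2 satisfies dE >= - k E dx, so that E exp(k x) is
nondecreasing, nonnegative and zero at 1. *)
Lemma string_sol_unique : p 1 = 0 -> q 1 = 0 ->
  forall x : R, 0 <= x <= 1 -> p x = 0 /\ q x = 0.
Proof.
move=> p1 q1 x /andP[x0 x1].
have [rs1 rs2] := ss_right S.
have r1 : r 1 = 0 by rewrite -rs2 p1 q1 !mulr0 addr0.
have s1 : s 1 = 0 by rewrite -[s 1]opprK -rs1 p1 q1 !mulr0 subr0 oppr0.
pose N := `|A| + `|D|.
have N0 : 0 <= N by rewrite addr_ge0.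
have b20 : 0 <= b2 by exact: le_trans b12.
pose k := 1 + 2 * N * b2.
have k0 : 0 <= k by rewrite addr_ge0// !mulr_ge0.
have dE := quad_diffD (quad_diffD (quad_diffM F_slope dp dp) (quad_diffM F_slope dq dq))
  (quad_diffD (quad_diffM F_slope dr dr) (quad_diffM F_slope ds ds)).
have dG := quad_diffM F_slope dE (quad_diff_expR F k0).
have := quad_diff_nondecreasing dG _ x0 x1 (lexx 1).
rewrite p1 q1 r1 s1 !mulr0 !addr0 mul0r => H.
suff H' : (p x * p x + q x * q x + (r x * r x + s x * s x)) * expR (k * x) <= 0.
  move: H'; rewrite pmulr_lle0 ?expR_gt0// => {}H.
  have := sqr_ge0 (p x); have := sqr_ge0 (q x); have := sqr_ge0 (r x).
  have := sqr_ge0 (s x); rewrite !expr2 => h1 h2 h3 h4.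
  by split; apply/eqP; rewrite -sqrf_eq0 expr2 eq_le; apply/andP; split; lra.
apply: H => a b a0 ab lb1.
have /andP[F0 F1] := F_slope a0 ab lb1.
rewrite /= -/A -/D; set e := expR _; have e0 : 0 <= e by exact: expR_ge0.
rewrite !mulr0 !addr0 ?add0r.
set P := p a; set Q := q a; set U := r a; set V := s a.
pose E := P * P + Q * Q + (U * U + V * V).
have E0 : 0 <= E by rewrite /E -!expr2 !addr_ge0// sqr_ge0.
have h1 : - E <= 2 * (P * U + Q * V).
  have := sqr_ge0 (P + U); have := sqr_ge0 (Q + V); rewrite /E; lra.
have h2 : - (2 * N * E) <=
    2 * (U * (- A * P + D * Q) + V * (- D * P + - A * Q)).
  have i1 : `|U * P + V * Q| <= E.
    rewrite ler_norml /E; have := sqr_ge0 (P + U); have := sqr_ge0 (Q + V).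
    by have := sqr_ge0 (P - U); have := sqr_ge0 (Q - V); lra.
  have i2 : `|U * Q - V * P| <= E.
    rewrite ler_norml /E; have := sqr_ge0 (Q + U); have := sqr_ge0 (P + V).
    by have := sqr_ge0 (Q - U); have := sqr_ge0 (P - V); lra.
  have j1 : `|A * (U * P + V * Q)| <= `|A| * E by rewrite normrM ler_wpM2l.
  have j2 : `|D * (U * Q - V * P)| <= `|D| * E by rewrite normrM ler_wpM2l.
  by move: j1 j2; rewrite !ler_norml /N => /andP[? ?] /andP[? ?]; lra.
rewrite -subr_ge0 in ab.
set f := F b - F a in F0 F1 *; set h := b - a in ab F1 *.
have i3 : 2 * N * E * f <= 2 * N * E * (b2 * h) by rewrite ler_wpM2l// !mulr_ge0.
have i4 := ler_wpM2r F0 h2.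
have i5 := ler_wpM2r ab h1.
have i6 : 0 <= 2 * (P * U + Q * V) * h + E * k * h +
   2 * (U * (- A * P + D * Q) + V * (- D * P + - A * Q)) * f.
  rewrite /k; nra.
have := mulr_ge0 e0 i6.
congr (_ <= _); rewrite /E; ring.
Qed.

(** Let h be the real part of - i conj(kappa) conj(y) y'. The equation gives
dh = - be (|y'|^2 dx + |kappa|^2 |y|^2 dF), while h(0) = 0 and
h(1) = - |kappa|^2 |y(1)|^2 by the boundary conditions. If be <= 0 then h is
nondecreasing, which forces y(1) = 0 and so y = 0. The factor
- i conj(kappa) makes a single argument work for every direction of kappa. *)
Lemma string_sol_Im_gt0 : (al != 0) || (be != 0) ->
  (exists2 x : R, 0 <= x <= 1 & (p x != 0) || (q x != 0)) -> 0 < be.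
Proof.
move=> k0 [x x01 nz]; rewrite ltNge; apply/negP => be0.
have dh := quad_diffD
  (quad_diffZ F_slope (- be) (quad_diffD (quad_diffM F_slope dp dr) (quad_diffM F_slope dq ds)))
  (quad_diffZ F_slope al (quad_diffD (quad_diffM F_slope dp ds)
     (quad_diffZ F_slope (-1) (quad_diffM F_slope dq dr)))).
have := quad_diff_nondecreasing dh _ (lexx 0) ler01 (lexx 1).
have [rs1 rs2] := ss_right S.
have [-> ->] := ss_left S.
rewrite !(mulr0, addr0) -rs2 -[s 1]opprK -rs1 => H.
have k2 : 0 < al ^+ 2 + be ^+ 2.
  case/orP: k0 => k0.
    by rewrite ltr_pwDl ?sqr_ge0// lt0r sqrf_eq0 k0 sqr_ge0.
  by rewrite ltr_pwDr ?sqr_ge0// lt0r sqrf_eq0 k0 sqr_ge0.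
have {}H : 0 <= - (al ^+ 2 + be ^+ 2) * (p 1 ^+ 2 + q 1 ^+ 2).
  apply: le_trans (H _) _; last by rewrite le_eqVlt; apply/orP; left; apply/eqP; ring.
  move=> a b a0 ab lb1; have /andP[F0 F1] := F_slope a0 ab lb1.
  rewrite -subr_ge0 in ab.
  have i1 : 0 <= - be * (r a ^+ 2 + s a ^+ 2) * (b - a).
    by rewrite !mulr_ge0// ?oppr_ge0// addr_ge0// sqr_ge0.
  have i2 : 0 <= - be * (al ^+ 2 + be ^+ 2) * (p a ^+ 2 + q a ^+ 2) * (F b - F a).
    by rewrite !mulr_ge0// ?oppr_ge0// addr_ge0// sqr_ge0.
  have := addr_ge0 i1 i2.
  congr (_ <= _); rewrite /A /D; ring.
have y1 : p 1 ^+ 2 + q 1 ^+ 2 = 0.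
  apply/eqP; rewrite eq_le; apply/andP; split; last by rewrite addr_ge0// sqr_ge0.
  by move: H; rewrite mulNr oppr_ge0 pmulr_rle0.
have := sqr_ge0 (p 1); have := sqr_ge0 (q 1) => q2 p2.
have p1 : p 1 = 0 by apply/eqP; rewrite -sqrf_eq0 eq_le p2 andbT; lra.
have q1 : q 1 = 0 by apply/eqP; rewrite -sqrf_eq0 eq_le q2 andbT; lra.
by have [px qx] := string_sol_unique p1 q1 x01; rewrite px qx eqxx in nz.
Qed.

End Uniqueness.

(** * Pointwise limits along an ultrafilter *)

(** Along an ultrafilter no subsequence has to be extracted: every bounded
function has a limit, and any number of functions converge simultaneously. *)
Lemma ultra_cvg_bounded (R : realType) (T : Type) (G : set_system T)
    (f : T -> R) (a b : R) : UltraFilter G ->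
  (\forall t \near G, a <= f t <= b) -> exists2 l, f @ G --> l & a <= l <= b.
Proof.
move=> UG fab.
have UfG : UltraFilter (f @ G).
  split; first exact: fmap_proper_filter.
  move=> H PH sH; rewrite predeqE => A; split => [HA|]; last exact: sH.
  have [//|GnA] := in_ultra_setVsetC (f @^-1` A) UG.
  have /sH HnA : (f @ G) (~` A) by [].
  by have [x []] := filter_ex (filterI HA HnA).
have := @segment_compact R a b; rewrite compact_ultra => /(_ _ UfG).
case; first by apply: filterS fab => t; rewrite /= in_itv.
by move=> l [/= lab fl]; exists l => //; move: lab; rewrite in_itv.
Qed.

Lemma cvg_norm_le (R : realType) (T : Type) (G : set_system T)
    (PG : ProperFilter G) (f : T -> R) (l c : R) :
  f @ G --> l -> (\forall t \near G, `|f t| <= c) -> `|l| <= c.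
Proof. by move=> fl; apply: cvgr_to_le; exact: cvg_norm. Qed.

Section Limit.
Variables (R : realType) (T : Type) (G : set_system T).
Hypothesis UG : UltraFilter G.
Variables (b1 b2 C al0 be0 : R) (al be x0 : T -> R) (F p q r s : T -> R -> R).
Hypotheses (b1_ge0 : 0 <= b1) (b12 : b1 <= b2).
Hypothesis cal : al @ G --> al0.
Hypothesis cbe : be @ G --> be0.
Hypothesis sol : \forall t \near G,
  string_sol b1 b2 (al t) (be t) C (F t) (p t) (q t) (r t) (s t).
Hypothesis F0 : \forall t \near G, F t 0 = 0.
Hypothesis x01 : \forall t \near G, 0 <= x0 t <= 1.
Hypothesis unit : \forall t \near G, p t (x0 t) ^+ 2 + q t (x0 t) ^+ 2 = 1.

Let PG : ProperFilter G. Proof. exact: ultra_proper. Qed.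

(* Limit rules for real functions along G. *)
Let cvB (f g : T -> R) (l m : R) : f @ G --> l -> g @ G --> m ->
  (fun t => f t - g t) @ G --> l - m.
Proof. exact: cvgB. Qed.

Let cvD (f g : T -> R) (l m : R) : f @ G --> l -> g @ G --> m ->
  (fun t => f t + g t) @ G --> l + m.
Proof. exact: cvgD. Qed.

Let cvM (f g : T -> R) (l m : R) : f @ G --> l -> g @ G --> m ->
  (fun t => f t * g t) @ G --> l * m.
Proof. exact: cvgM. Qed.

Let cvN (f : T -> R) (l : R) : f @ G --> l -> (fun t => - f t) @ G --> - l.
Proof. exact: cvgN. Qed.

Let cvnorm (f : T -> R) (l : R) : f @ G --> l -> (fun t => `|f t|) @ G --> `|l|.
Proof. exact: cvg_norm. Qed.

Let cvle (f g : T -> R) (l m : R) : f @ G --> l -> g @ G --> m ->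
  (\forall t \near G, f t <= g t) -> l <= m.
Proof.
move=> fl gm fg; rewrite -subr_ge0; apply: (cvgr_to_ge (cvB gm fl)).
by apply: filterS fg => t; rewrite subr_ge0.
Qed.

Let nle (f : T -> R) (l c : R) :
  f @ G --> l -> (\forall t \near G, `|f t| <= c) -> `|l| <= c.
Proof. exact: cvg_norm_le. Qed.

Let lm (f : T -> R -> R) (x : R) : R := lim (f ^~ x @ G).

Let cvg_lm (f : T -> R -> R) (c : R) :
  (\forall t \near G, forall x : R, 0 <= x <= 1 -> `|f t x| <= c) ->
  forall x : R, 0 <= x <= 1 -> f ^~ x @ G --> lm f x.
Proof.
move=> H x xI.
have [l fl _] : exists2 l, f ^~ x @ G --> l & - c <= l <= c.
  by apply: ultra_cvg_bounded; apply: filterS H => t /(_ x xI); rewrite ler_norml.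
by apply: cvgP fl.
Qed.

Let cp (x : R) : 0 <= x <= 1 -> p ^~ x @ G --> lm p x.
Proof. by apply: (@cvg_lm p C); apply: filterS sol => t S y /(ss_bnd S)[]. Qed.

Let cq (x : R) : 0 <= x <= 1 -> q ^~ x @ G --> lm q x.
Proof. by apply: (@cvg_lm q C); apply: filterS sol => t S y /(ss_bnd S)[]. Qed.

Let cr (x : R) : 0 <= x <= 1 -> r ^~ x @ G --> lm r x.
Proof. by apply: (@cvg_lm r C); apply: filterS sol => t S y /(ss_bnd S)[]. Qed.

Let cs (x : R) : 0 <= x <= 1 -> s ^~ x @ G --> lm s x.
Proof. by apply: (@cvg_lm s C); apply: filterS sol => t S y /(ss_bnd S)[]. Qed.

Let cF : forall x : R, 0 <= x <= 1 -> F ^~ x @ G --> lm F x.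
Proof.
apply: (@cvg_lm _ b2); near=> t => x /andP[x0_ x1].
have Ft0 : F t 0 = 0 by near: t.
have S : string_sol b1 b2 (al t) (be t) C (F t) (p t) (q t) (r t) (s t) by near: t.
have := ss_F S (lexx 0) x0_ x1; rewrite Ft0 !subr0 => /andP[h1 h2].
have b10 : 0 <= b1 * x by rewrite mulr_ge0.
have : b2 * x <= b2 by rewrite ler_piMr// (le_trans b1_ge0).
by rewrite ler_norml; lra.
Unshelve. all: by end_near. Qed.

(** Every condition is a closed condition on finitely many values of the
functions, so it passes to the pointwise limits. *)
Lemma string_sol_limit : string_sol b1 b2 al0 be0 C (lm F) (lm p) (lm q) (lm r) (lm s).
Proof.
have I (a b : R) : 0 <= a -> a <= b -> b <= 1 -> (0 <= a <= 1) * (0 <= b <= 1) :> Prop.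
  by move=> a0 ab b1_; split; apply/andP; split=> //; lra.
have I0 : 0 <= (0:R) <= 1 by rewrite lexx ler01.
have I1 : 0 <= (1:R) <= 1 by rewrite lexx ler01.
have cA : (fun t => al t ^+ 2 - be t ^+ 2) @ G --> al0 ^+ 2 - be0 ^+ 2.
  by apply: cvB; apply: cvM.
have cD : (fun t => 2 * al t * be t) @ G --> 2 * al0 * be0.
  by apply: cvM => //; apply: cvM => //; exact: cvg_cst.
split.
- move=> a b a0 ab lb1; have [aI bI] := I a b a0 ab lb1.
  have c : (fun t => F t b - F t a) @ G --> lm F b - lm F a by exact: cvB (cF bI) (cF aI).
  apply/andP; split.
    by apply: (cvgr_to_ge c); apply: filterS sol => t S; have /andP[] := ss_F S a0 ab lb1.
  by apply: (cvgr_to_le c); apply: filterS sol => t S; have /andP[] := ss_F S a0 ab lb1.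
- move=> a b a0 ab lb1; have [aI bI] := I a b a0 ab lb1.
  apply: (@nle (fun t => p t b - p t a - r t a * (b - a))).
    by apply: cvB; [exact: cvB (cp bI) (cp aI)|apply: cvM; [exact: cr|exact: cvg_cst]].
  by apply: filterS sol => t S; exact: (ss_p S).
- move=> a b a0 ab lb1; have [aI bI] := I a b a0 ab lb1.
  apply: (@nle (fun t => q t b - q t a - s t a * (b - a))).
    by apply: cvB; [exact: cvB (cq bI) (cq aI)|apply: cvM; [exact: cs|exact: cvg_cst]].
  by apply: filterS sol => t S; exact: (ss_q S).
- move=> a b a0 ab lb1; have [aI bI] := I a b a0 ab lb1.
  apply: (@nle (fun t => r t b - r t a +
    ((al t ^+ 2 - be t ^+ 2) * p t a - 2 * al t * be t * q t a) * (F t b - F t a))).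
    apply: cvD; first exact: cvB (cr bI) (cr aI).
    apply: cvM; last exact: cvB (cF bI) (cF aI).
    by apply: cvB; apply: cvM => //; [exact: cp|exact: cq].
  by apply: filterS sol => t S; exact: (ss_r S).
- move=> a b a0 ab lb1; have [aI bI] := I a b a0 ab lb1.
  apply: (@nle (fun t => s t b - s t a +
    (2 * al t * be t * p t a + (al t ^+ 2 - be t ^+ 2) * q t a) * (F t b - F t a))).
    apply: cvD; first exact: cvB (cs bI) (cs aI).
    apply: cvM; last exact: cvB (cF bI) (cF aI).
    by apply: cvD; apply: cvM => //; [exact: cp|exact: cq].
  by apply: filterS sol => t S; exact: (ss_s S).
- move=> x xI; split.
  + by apply: (nle (cp xI)); apply: filterS sol => t S; have [] := ss_bnd S xI.
  + by apply: (nle (cq xI)); apply: filterS sol => t S; have [] := ss_bnd S xI.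
  + by apply: (nle (cr xI)); apply: filterS sol => t S; have [] := ss_bnd S xI.
  + by apply: (nle (cs xI)); apply: filterS sol => t S; have [] := ss_bnd S xI.
- split; apply/eqP; rewrite -normr_le0.
    by apply: (nle (cr I0)); apply: filterS sol => t /ss_left[-> _]; rewrite normr0.
  by apply: (nle (cs I0)); apply: filterS sol => t /ss_left[_ ->]; rewrite normr0.
- split; apply/eqP; rewrite -subr_eq0 -normr_le0.
    apply: (@nle (fun t => al t * p t 1 - be t * q t 1 - - s t 1)).
      apply: cvB; last by apply: cvN; exact: cs.
      by apply: cvB; apply: cvM => //; [exact: cp|exact: cq].
    by apply: filterS sol => t /ss_right[-> _]; rewrite subrr normr0.
  apply: (@nle (fun t => al t * q t 1 + be t * p t 1 - r t 1)).
    apply: cvB; last exact: cr.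
    by apply: cvD; apply: cvM => //; [exact: cq|exact: cp].
  by apply: filterS sol => t /ss_right[_ ->]; rewrite subrr normr0.
Qed.

(** The points x0 t where |y| = 1 move with t. They have a limit x, and the
functions are Lipschitz with a constant that does not depend on t, so the
values at x0 t have the same limit as the values at x. *)
Lemma string_sol_limit_unit : exists2 x : R, 0 <= x <= 1 & lm p x ^+ 2 + lm q x ^+ 2 = 1.
Proof.
have [x cx xI] := ultra_cvg_bounded UG x01; exists x => //.
have near_pq (f g : T -> R -> R) :
    (\forall t \near G, forall a b : R, 0 <= a -> a <= b -> b <= 1 ->
      `|f t b - f t a - g t a * (b - a)| <= C * (b - a) ^+ 2) ->
    (\forall t \near G, forall y : R, 0 <= y <= 1 -> `|f t y| <= C) ->
    (\forall t \near G, forall y : R, 0 <= y <= 1 -> `|g t y| <= C) ->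
    (fun t => f t (x0 t)) @ G --> lm f x.
  move=> fg bf bg.
  have [l cl _] : exists2 l, (fun t => f t (x0 t)) @ G --> l & - C <= l <= C.
    apply: (ultra_cvg_bounded UG); near=> t; rewrite -ler_norml.
    have b : forall y : R, 0 <= y <= 1 -> `|f t y| <= C by near: t.
    by apply: b; near: t.
  suff -> : lm f x = l by [].
  apply/eqP; rewrite -subr_eq0 -normr_le0.
  have c1 : (fun t => `|f t x - f t (x0 t)|) @ G --> `|lm f x - l|.
    by apply: cvnorm; apply: cvB => //; exact: (cvg_lm bf xI).
  (* 2 * C is a common Lipschitz constant: C for the slope, C for the error *)
  have c2 : (fun t => 2 * C * `|x - x0 t|) @ G --> 2 * C * `|x - x|.
    by apply: cvM; [exact: cvg_cst|apply: cvnorm; apply: cvB => //; exact: cvg_cst].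
  rewrite subrr normr0 mulr0 in c2.
  apply: cvle c1 c2 _; near=> t.
  have bf' : forall y : R, 0 <= y <= 1 -> `|f t y| <= C by near: t.
  have bg' : forall y : R, 0 <= y <= 1 -> `|g t y| <= C by near: t.
  have fg' : forall a b : R, 0 <= a -> a <= b -> b <= 1 ->
      `|f t b - f t a - g t a * (b - a)| <= C * (b - a) ^+ 2 by near: t.
  have tI : 0 <= x0 t <= 1 by near: t.
  have C0 : 0 <= C by exact: le_trans (bf' x xI).
  have lip (a b : R) : 0 <= a -> a <= b -> b <= 1 ->
      `|f t b - f t a| <= 2 * C * (b - a).
    move=> a0 ab lb1; have := fg' a b a0 ab lb1.
    have : `|g t a * (b - a)| <= C * (b - a).
      rewrite normrM (ger0_norm (_ : 0 <= b - a)) ?subr_ge0// ler_wpM2r ?subr_ge0//.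
      by apply: bg'; rewrite a0 (le_trans ab).
    have : C * (b - a) ^+ 2 <= C * (b - a).
      by rewrite expr2 ler_wpM2l// ler_piMr ?subr_ge0//; lra.
    by rewrite !ler_norml; lra.
  move: xI tI => /andP[x0_ x1_] /andP[t0 t1].
  have [xt|/ltW xt] := leP x (x0 t).
    by rewrite distrC [`|x - _|]distrC (ger0_norm (_ : 0 <= x0 t - x)) ?subr_ge0// lip.
  by rewrite (ger0_norm (_ : 0 <= x - x0 t)) ?subr_ge0// lip.
have P : (fun t => p t (x0 t)) @ G --> lm p x.
  apply: (near_pq p r); apply: filterS sol => t S.
  - by move=> a b; exact: (ss_p S).
  - by move=> y /(ss_bnd S)[].
  - by move=> y /(ss_bnd S)[].
have Q : (fun t => q t (x0 t)) @ G --> lm q x.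
  apply: (near_pq q s); apply: filterS sol => t S.
  - by move=> a b; exact: (ss_q S).
  - by move=> y /(ss_bnd S)[].
  - by move=> y /(ss_bnd S)[].
apply/eqP; rewrite -subr_eq0 -normr_le0.
apply: (@nle (fun t => p t (x0 t) ^+ 2 + q t (x0 t) ^+ 2 - 1)).
  apply: cvB; last exact: cvg_cst.
  by apply: cvD; apply: cvM.
by apply: filterS unit => t ->; rewrite subrr normr0.
Unshelve. all: by end_near. Qed.

End Limit.

(** * Integrals over subintervals of the unit interval *)

(** Bounded measurable functions on (0,1), with pointwise instead of essential
bounds, so that their integrals can be estimated pointwise. *)
Definition mbounded (R : realType) (f : R -> R) : Prop :=
  measurable_fun (I01 : set R) f /\ exists M : R, forall x, I01 x -> `|f x| <= M.

Definition itg (R : realType) (f : R -> R) (a b : R) : R :=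
  \int[@lebesgue_measure R]_(x in `]a, b[%classic) f x.

Section Integrals.
Variable R : realType.
Implicit Types (f g : R -> R) (a b c : R).
Local Notation mu := (@lebesgue_measure R).

Lemma I01E x : (I01 : set R) x <-> 0 < x < 1.
Proof. by rewrite /I01 /= in_itv. Qed.

Lemma measurable_I01 : measurable (I01 : set R).
Proof. exact: measurable_itv. Qed.

Lemma sub_I01 a b : 0 <= a -> b <= 1 -> `]a, b[%classic `<=` (I01 : set R).
Proof.
move=> a0 b1 x; rewrite /= in_itv/= => /andP[ax xb]; apply/I01E.
by rewrite (le_lt_trans a0)// (lt_le_trans xb).
Qed.

Lemma ae01W (P Q : R -> Prop) : (forall x, I01 x -> P x -> Q x) ->
  ae01 P -> ae01 Q.
Proof.
move=> PQ; have FF : Filter (almost_everywhere mu) by exact: ae_filter_ringOfSetsType.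
by apply: (@filterS _ _ FF) => x Px xI; apply: PQ => //; exact: Px.
Qed.

Lemma ae01I (P Q : R -> Prop) : ae01 P -> ae01 Q -> ae01 (fun x => P x /\ Q x).
Proof.
have FF : Filter (almost_everywhere mu) by exact: ae_filter_ringOfSetsType.
by apply: (@filterS2 _ _ FF) => x Px Qx xI; split; [exact: Px|exact: Qx].
Qed.

Lemma mbounded_cst c : mbounded (fun=> c).
Proof. by split; [exact: measurable_cst|exists `|c|]. Qed.

Lemma mboundedD f g : mbounded f -> mbounded g -> mbounded (fun x => f x + g x).
Proof.
move=> [mf [M fM]] [mg [N gN]]; split; first exact: measurable_funD.
exists (M + N) => x xI.
by rewrite (le_trans (ler_normD _ _))// lerD// ?fM// gN.
Qed.

Lemma mboundedM f g : mbounded f -> mbounded g -> mbounded (fun x => f x * g x).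
Proof.
move=> [mf [M fM]] [mg [N gN]]; split; first exact: measurable_funM.
exists (M * N) => x xI.
by rewrite normrM ler_pM// ?fM// gN.
Qed.

Lemma mboundedZ c f : mbounded f -> mbounded (fun x => c * f x).
Proof. by move=> bf; apply: mboundedM => //; exact: mbounded_cst. Qed.

Lemma mboundedB f g : mbounded f -> mbounded g -> mbounded (fun x => f x - g x).
Proof.
move=> bf bg; have := mboundedD bf (mboundedZ (-1) bg).
by congr mbounded; apply/funext => x; rewrite mulN1r.
Qed.

Lemma within_continuous_bounded f : {within `[0, 1]%classic, continuous f} ->
  exists M : R, forall x, 0 <= x <= 1 -> `|f x| <= M.
Proof.
move=> cf.
have [M [_ HM]] := compact_bounded (continuous_compact cf (@segment_compact R 0 1)).
exists (M + 1) => x xI; apply: (HM (M + 1)); first by rewrite ltrDl.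
by exists x => //; rewrite /= in_itv.
Qed.

Lemma mbounded_continuous f : {within `[0, 1]%classic, continuous f} -> mbounded f.
Proof.
move=> cf; split.
  have h : measurable_fun (`[0, 1]%classic : set R) f by exact: subspace_continuous_measurable_fun.
  apply: measurable_funS h => // x /I01E.
  by rewrite /= in_itv/= => /andP[/ltW -> /ltW ->].
have [M HM] := within_continuous_bounded cf.
by exists M => x /I01E /andP[x0 x1]; apply: HM; rewrite !ltW.
Qed.

Lemma mbounded_integrable f a b : mbounded f -> 0 <= a -> b <= 1 ->
  mu.-integrable `]a, b[ (EFin \o f).
Proof.
move=> [mf [M fM]] a0 b1; apply: measurable_bounded_integrable => //.
- rewrite /= lebesgue_measure_itv/=; case: ifP => // _.
  by rewrite -EFinB ltry.
- by apply: measurable_funS mf => //; [exact: measurable_I01|exact: sub_I01].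
- exists M; split; first exact: num_real.
  move=> y My x xab; rewrite /= (le_trans (fM x _)) ?(ltW My)//.
  exact: sub_I01 xab.
Qed.

Lemma itgD f g a b : mbounded f -> mbounded g -> 0 <= a -> b <= 1 ->
  itg (fun x => f x + g x) a b = itg f a b + itg g a b.
Proof. by move=> bf bg a0 b1; rewrite /itg RintegralD//; exact: mbounded_integrable. Qed.

Lemma itgB f g a b : mbounded f -> mbounded g -> 0 <= a -> b <= 1 ->
  itg (fun x => f x - g x) a b = itg f a b - itg g a b.
Proof. by move=> bf bg a0 b1; rewrite /itg RintegralB//; exact: mbounded_integrable. Qed.

Lemma itgZ c f a b : mbounded f -> 0 <= a -> b <= 1 ->
  itg (fun x => c * f x) a b = c * itg f a b.
Proof. by move=> bf a0 b1; rewrite /itg RintegralZl//; exact: mbounded_integrable. Qed.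

Lemma itg_cst c a b : a <= b -> itg (fun=> c) a b = c * (b - a).
Proof.
rewrite le_eqVlt => /predU1P[->|ab].
  by rewrite /itg set_itv_ge ?bnd_simp ?ltxx// Rintegral_set0 subrr mulr0.
by rewrite /itg Rintegral_cst//= lebesgue_measure_itv/= lte_fin ab.
Qed.

Lemma itgxx f a : itg f a a = 0.
Proof. by rewrite /itg set_itv_ge ?bnd_simp ?ltxx// Rintegral_set0. Qed.

Lemma eq_itg f g a b : (forall x, a < x < b -> f x = g x) ->
  itg f a b = itg g a b.
Proof.
by move=> fg; apply: eq_Rintegral => x; rewrite inE/= in_itv/= => /fg.
Qed.

Lemma itg_split f a c b : mbounded f -> 0 <= a -> a <= c -> c <= b -> b <= 1 ->
  itg f a b = itg f a c + itg f c b.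
Proof.
move=> bf a0; rewrite le_eqVlt => /predU1P[->|ac]; first by rewrite itgxx add0r.
rewrite le_eqVlt => /predU1P[->|cb] b1; first by rewrite itgxx addr0.
have h1 : \int[mu]_(x in `]a, c[) f x = \int[mu]_(x in `]a, c]) f x.
  by apply: Rintegral_itv_bndo_bndc; apply: mbounded_integrable => //; rewrite (le_trans (ltW cb)).
have h2 : \int[mu]_(x in `]a, b[) f x - \int[mu]_(x in `]a, c]) f x =
    \int[mu]_(x in `]c, b[) f x.
  by apply: Rintegral_itvB; [exact: mbounded_integrable|rewrite bnd_simp// ltW..].
by rewrite /itg h1 -h2 addrC subrK.
Qed.

Lemma ler_itg f g a b : mbounded f -> mbounded g -> 0 <= a -> b <= 1 ->
  (forall x, a < x < b -> f x <= g x) -> itg f a b <= itg g a b.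
Proof.
move=> bf bg a0 b1 fg; apply: le_Rintegral => //; try exact: mbounded_integrable.
Qed.

Lemma itg_norm_le f a b M : mbounded f -> 0 <= a -> a <= b -> b <= 1 ->
  (forall x, a < x < b -> `|f x| <= M) -> `|itg f a b| <= M * (b - a).
Proof.
move=> bf a0 ab b1 fM; rewrite ler_norml; apply/andP; split.
  rewrite -mulNr -itg_cst//; apply: ler_itg => //; first exact: mbounded_cst.
  by move=> x /fM; rewrite ler_norml => /andP[].
rewrite -itg_cst//; apply: ler_itg => //; first exact: mbounded_cst.
by move=> x /fM; rewrite ler_norml => /andP[].
Qed.

Lemma ae_eq_itg f g a b : measurable_fun (I01 : set R) f ->
  measurable_fun (I01 : set R) g -> 0 <= a -> b <= 1 ->
  ae01 (fun x => f x = g x) -> itg f a b = itg g a b.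
Proof.
move=> mf mg a0 b1 fg; rewrite /itg /Rintegral; congr fine.
apply: ae_eq_integral => //.
- apply/measurable_EFinP; apply: measurable_funS mf; [exact: measurable_I01|exact: sub_I01].
- apply/measurable_EFinP; apply: measurable_funS mg; [exact: measurable_I01|exact: sub_I01].
- have FF : Filter (almost_everywhere mu) by exact: ae_filter_ringOfSetsType.
  apply: (@filterS _ _ FF _ _ _ fg) => x H xab; rewrite /= H//.
  exact: sub_I01 xab.
Qed.

Lemma in_Linfty_measurable f : in_Linfty f -> measurable_fun (I01 : set R) f.
Proof.
move=> /andP[]; rewrite inE => mf _.
exact/(measurable_restrictT f measurable_I01).
Qed.

Lemma mbounded_in_Linfty f : mbounded f -> in_Linfty f.
Proof.
move=> [mf [M fM]]; apply/andP; split.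
  by rewrite inE; exact/(measurable_restrictT f measurable_I01).
rewrite inE /= /finite_norm unlock; case: ifP => // _.
apply: (@le_lt_trans _ _ (`|M|%:E)); last by rewrite ltry.
apply/ess_supP; apply: nearW => x /=; rewrite lee_fin /patch.
case: ifPn; rewrite ?normr0// => /set_mem xI.
by rewrite (le_trans (fM x xI))// ler_norm.
Qed.

End Integrals.

(** * Smooth bumps *)

Section Bump.
Variable R : realType.
Implicit Types (P : {poly R}) (n : nat) (x : R).

(** Used at points where a formula for the derivative is not available: flat
points of bumps, and trivially for affine functions. *)
Lemma is_derive_quad (f : R -> R) (x d C : R) :
  (forall y, `|f y - f x - d * (y - x)| <= C * (y - x) ^+ 2) ->
  is_derive x 1 f d.
Proof.
move=> H.
have C0 : 0 <= C.
  have := H (x + 1); rewrite (_ : x + 1 - x = 1); last by ring.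
  by rewrite expr1n !mulr1 => h; exact: le_trans (normr_ge0 _) h.
have cf : (fun h => h^-1 *: ((f \o shift x) (h *: (1 : R)) - f x)) @ 0^' --> (d : R).
  apply/cvgrPdist_le => e e0; near=> h.
  have h0 : h != 0 by near: h; exact: nbhs_dnbhs_neq.
  have hd : `|h| <= e / (C + 1).
    near: h; apply: dnbhs0_le; rewrite divr_gt0//; lra.
  rewrite /= /GRing.scale/= mulr1.
  have -> : d - h^-1 * (f (h + x) - f x) =
      - (h^-1 * (f (h + x) - f x - d * (h + x - x))).
    by rewrite addrK; field.
  rewrite normrN normrM normfV ler_pdivrMl ?normr_gt0//.
  rewrite (le_trans (H _))// addrK -[h ^+ 2]ger0_norm ?sqr_ge0// normrX expr2.
  rewrite mulrCA ler_wpM2l//.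
  have C1 : 0 < C + 1 by lra.
  move: hd; rewrite ler_pdivlMr//.
  have := normr_ge0 h; nra.
split; first by apply/cvg_ex; exists d.
by apply: cvg_lim.
Unshelve. all: by end_near. Qed.

Let W : {poly R} := 'X - 'X^2.

Let WE x : W.[x] = x * (1 - x).
Proof. by rewrite /W !hornerE expr2; ring. Qed.

Let W_gt0 x : 0 < x < 1 -> 0 < W.[x].
Proof. by move=> /andP[x0 x1]; rewrite WE mulr_gt0// subr_gt0. Qed.

(** P(x) w^-n exp(-1/w) on (0,1), where w = x (1 - x). The family contains the
classical bump exp(-1/w) and is closed under differentiation, which makes all
its members smooth. *)
Definition bump P n x : R :=
  if 0 < x < 1 then P.[x] * (x * (1 - x))^-1 ^+ n * expR (- (x * (1 - x))^-1)
  else 0.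

(** Since (w^-1)' = - (1 - 2 x) w^-2, the derivative of P w^-n exp(-1/w) is
this polynomial times w^-(n+2) exp(-1/w). *)
Definition bump_deriv P n : {poly R} :=
  P^`() * W ^+ 2 - n%:R *: (P * (1 - 2%:R *: 'X) * W) + P * (1 - 2%:R *: 'X).

Lemma bump_out P n x : ~~ (0 < x < 1) -> bump P n x = 0.
Proof. by rewrite /bump => /negPf ->. Qed.

(** exp(-1/w) is smaller than any power of w. The exponent 2 is what makes the
bump differentiable, with derivative 0, at the endpoints 0 and 1. *)
Lemma bump_le P n : exists C : R, forall x, 0 < x < 1 ->
  `|bump P n x| <= C * (x * (1 - x)) ^+ 2.
Proof.
have [M HM] : exists M : R, forall x, 0 <= x <= 1 -> `|P.[x]| <= M.
  by apply: within_continuous_bounded; apply: continuous_subspaceT; exact: continuous_horner.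
pose m := n.+2.
exists (M * m%:R ^+ m) => x x01; rewrite /bump x01.
have Wx := W_gt0 x01; rewrite WE in Wx.
set w := x * (1 - x) in Wx *.
have wn : 0 <= w^-1 ^+ n by rewrite exprn_ge0// invr_ge0 ltW.
rewrite !normrM (ger0_norm (expR_ge0 _)) (ger0_norm wn).
have m0 : 0 < (m%:R : R) by rewrite ltr0n.
(* exp(-t) = exp(-t/m)^m <= (m/t)^m, for t = 1/w *)
have Ew : expR (- w^-1) <= (m%:R * w) ^+ m.
  have -> : - w^-1 = - (m%:R * w)^-1 * m%:R.
    move: (m%:R : R) m0 => k k0; field.
    by rewrite !gt_eqF.
  rewrite expRM_natr.
  have kw : 0 < m%:R * w by rewrite mulr_gt0.
  apply: lerXn2r; rewrite ?nnegrE ?expR_ge0 ?(ltW kw)//.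
  rewrite expRN -[leRHS]invrK lef_pV2 ?posrE ?expR_gt0 ?invr_gt0//.
  by apply: le_trans (expR_ge1Dx _); rewrite lerDr.
have -> : M * m%:R ^+ m * w ^+ 2 = M * w^-1 ^+ n * (m%:R * w) ^+ m.
  rewrite [(m%:R * w) ^+ m]exprMn (_ : w ^+ m = w ^+ n * w ^+ 2); last by rewrite -exprD addn2.
  rewrite exprVn; move: (m%:R ^+ m) => K; field.
  by rewrite expf_neq0// gt_eqF.
apply: ler_pM => //; first exact: mulr_ge0.
by rewrite ler_wpM2r// HM//; case/andP: x01 => /ltW -> /ltW ->.
Qed.

Lemma is_derive_bump P n x :
  is_derive x 1 (bump P n) (bump (bump_deriv P n) n.+2 x).
Proof.
have [x01|x01] := boolP (0 < x < 1); last first.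
  (* for y in (0,1) and x outside, w(y) = y (1 - y) is at most |y - x| *)
  rewrite bump_out//; have [C HC] := bump_le P n.
  apply: (@is_derive_quad _ _ _ `|C|) => y.
  rewrite (@bump_out _ _ x)// mul0r !subr0.
  have [y01|y01] := boolP (0 < y < 1); last first.
    by rewrite bump_out// normr0 mulr_ge0// sqr_ge0.
  apply: le_trans (HC y y01) _.
  apply: (@le_trans _ _ (`|C| * (y * (1 - y)) ^+ 2)).
    by rewrite ler_wpM2r ?sqr_ge0// ler_norm.
  rewrite ler_wpM2l//.
  move: x01 y01; rewrite negb_and -!leNgt => /orP[x0|x1] /andP[y0 y1].
    by apply: lerXn2r; rewrite ?nnegrE; nra.
  rewrite -[leRHS]sqrrN; apply: lerXn2r; rewrite ?nnegrE; nra.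
apply: (@near_eq_is_derive _ _ _
  (fun y => P.[y] * (W.[y])^-1 ^+ n * expR (- (W.[y])^-1))).
  have : \forall y \near x, y \in `]0, 1[%R.
    by apply: near_in_itvoo; rewrite in_itv.
  by apply: filterS => y; rewrite in_itv/= /bump => ->; rewrite WE.
have Wx := W_gt0 x01.
have W0 : W.[x] != 0 by exact: lt0r_neq0.
have dW := is_derive_poly W x.
have dV := is_deriveV W0 dW.
have dX := is_deriveX n dV.
have dN := is_deriveN dV.
have dE := @is_derive1_comp _ expR _ x _ _ (is_derive_expR _) dN.
have dM := is_deriveM (is_deriveM (is_derive_poly P x) dX) dE.
rewrite (_ : (fun y => _) = horner P * (fun y => (W.[y])^-1) ^+ n *
  (expR \o - (fun y => (W.[y])^-1))); last first.
  by apply/funext => y; rewrite exprfctE.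
apply: (is_derive_eq dM).
have W'E : W^`().[x] = 1 - 2 * x.
  by rewrite /W derivB derivX derivXn /= !hornerE /=; ring.
have PE : (bump_deriv P n).[x] = P^`().[x] * W.[x] ^+ 2 -
    n%:R * (P.[x] * (1 - 2 * x) * W.[x]) + P.[x] * (1 - 2 * x).
  by rewrite /bump_deriv !(hornerD, hornerN, hornerM, hornerZ, horner_exp) !hornerC hornerX.
rewrite /bump x01 -WE PE W'E !fctE /GRing.scale /=.
move: (expR _) => e; move: (P.[x]) (P^`().[x]) (W.[x]) W0 => p p' w w0.
clear dW dV dX dN dE dM PE; case: n => [|k]; first by rewrite expr0; field.
rewrite !exprS /=; move: (w^-1 ^+ k) => T.
by field.
Qed.

End Bump.

(** * Plateau functions *)

Section Calculus.
Variable R : realType.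
Implicit Types f df : R -> R.

Lemma is_derive_continuous f df : (forall x : R, is_derive x 1 f (df x)) -> continuous f.
Proof.
move=> fdf x; apply/differentiable_continuous/derivable1_diffP.
by case: (fdf x).
Qed.

Lemma MVT_global f df (a b : R) : (forall x : R, is_derive x 1 f (df x)) -> a < b ->
  exists2 c, a < c < b & f b - f a = df c * (b - a).
Proof.
move=> fdf ab; have [|c cab ->] := @MVT R f df a b ab (fun x _ => fdf x).
  by apply: continuous_subspaceT; exact: is_derive_continuous fdf.
by exists c => //; move: cab; rewrite in_itv.
Qed.

Lemma itg_FTC f df (a b : R) : (forall x : R, is_derive x 1 f (df x)) ->
  continuous df -> a <= b -> itg df a b = f b - f a.
Proof.
move=> fdf cdf; rewrite le_eqVlt => /predU1P[->|ab]; first by rewrite itgxx subrr.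
have cf := is_derive_continuous fdf.
have h : (\int[@lebesgue_measure R]_(x in `[a, b]) (df x)%:E = (f b)%:E - (f a)%:E)%E.
  apply: continuous_FTC2 => //; first exact: continuous_subspaceT.
    split.
    - by move=> x _; case: (fdf x).
    - by apply: cvg_at_right_filter; exact: cf.
    - by apply: cvg_at_left_filter; exact: cf.
  by move=> x _; rewrite derive1E; case: (fdf x).
rewrite /itg /Rintegral -(@integral_itv_bndoo _ a b _ true false) ?h//.
apply/measurable_EFinP; apply: measurable_funTS.
exact: continuous_measurable_fun.
Qed.

Lemma derive1_is_derive f df : (forall x : R, is_derive x 1 f (df x)) -> derive1 f = df.
Proof. by move=> fdf; apply/funext => x; rewrite derive1E; case: (fdf x). Qed.

End Calculus.

Section SmoothStep.
Variable R : realType.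
Local Notation mu := (@lebesgue_measure R).

Let rho : R -> R := bump 1 0.

Let rho_ge0 (x : R) : 0 <= rho x.
Proof.
rewrite /rho /bump; case: ifP => // _.
by rewrite expr0 mulr1 hornerC mul1r expR_ge0.
Qed.

Let rho_gt0 (x : R) : 0 < x < 1 -> 0 < rho x.
Proof. by move=> x01; rewrite /rho /bump x01 expr0 mulr1 hornerC mul1r expR_gt0. Qed.

Let rho_out (x : R) : ~~ (0 < x < 1) -> rho x = 0.
Proof. exact: bump_out. Qed.

Let rho_cont : continuous rho.
Proof. exact: is_derive_continuous (@is_derive_bump R 1 0). Qed.

(** A smooth function that vanishes on the left of 0 and is a positive constant
on the right of 1. Integrating from -1 puts the point 0 inside the interval
where the fundamental theorem of calculus applies. *)
Definition smooth_step (x : R) : R := \int[mu]_(t in `[-1, x]) bump 1 0 t.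

Local Notation G := smooth_step.

Lemma smooth_step_le0 (x : R) : x <= 0 -> G x = 0.
Proof.
move=> x0; rewrite /G (@eq_Rintegral _ _ _ _ _ (fun=> 0)).
  by rewrite Rintegral_cst// mul0r.
move=> t; rewrite inE/= in_itv/= => /andP[_ tx]; apply: rho_out.
by rewrite negb_and -leNgt (le_trans tx).
Qed.

Lemma is_derive_smooth_step (x : R) : is_derive x 1 G (rho x).
Proof.
have [x0|x0] := ltP x 0.
  rewrite rho_out; last by rewrite negb_and -leNgt ltW.
  have d0 : is_derive x (1 : R) (fun _ : R => (0 : R)) 0 by exact: is_derive_cst.
  apply: near_eq_is_derive d0.
  have : \forall y \near x, y < 0 by exact: lt_nbhsl.
  by apply: filterS => y y0; rewrite smooth_step_le0// ltW.
have [||||dG GE] := @continuous_FTC1_closed R rho (-1) x (x + 1).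
- by rewrite ltrDl.
- apply: continuous_compact_integrable; first exact: segment_compact.
  exact: continuous_subspaceT.
- by rewrite (lt_le_trans _ x0)// ltrN10.
- exact: rho_cont.
by split; [exact: dG|rewrite -derive1E].
Qed.

Let G_nd (x y : R) : x <= y -> G x <= G y.
Proof.
rewrite le_eqVlt => /predU1P[->//|xy].
have [c _ h] := MVT_global is_derive_smooth_step xy.
by rewrite -subr_ge0 h mulr_ge0// subr_ge0 ltW.
Qed.

Lemma smooth_step_ge1 (x : R) : 1 <= x -> G x = G 1.
Proof.
rewrite le_eqVlt => /predU1P[<-//|x1].
have [c /andP[c1 _] h] := MVT_global is_derive_smooth_step x1.
move/eqP: h; rewrite rho_out ?mul0r ?subr_eq0; first by move/eqP.
by rewrite negb_and -!leNgt (ltW c1) orbT.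
Qed.

Lemma smooth_step1_gt0 : 0 < G 1.
Proof.
have [c c01 h] := MVT_global is_derive_smooth_step ltr01.
by move: h; rewrite (smooth_step_le0 (lexx 0)) !subr0 mulr1 => ->; exact: rho_gt0.
Qed.

Lemma smooth_step_bnd (x : R) : 0 <= G x <= G 1.
Proof.
apply/andP; split.
  have [x0|/ltW x0] := leP x 0; first by rewrite smooth_step_le0.
  by rewrite -(smooth_step_le0 (lexx 0)) G_nd.
have [x1|/ltW x1] := leP x 1; first exact: G_nd.
by rewrite smooth_step_ge1.
Qed.

(** A smooth approximation of [smooth_step 1] times the indicator function of
[a, b], with transitions of length e. *)
Definition plateau (a b e x : R) : R := G ((x - a) / e) - G ((x - b) / e).

Let bumps (a b e : R) P n (x : R) : R :=
  bump P n ((x - a) / e) - bump P n ((x - b) / e).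

Let is_derive_affine (f : R -> R) (df a e x : R) : is_derive ((x - a) / e) 1 f df ->
  is_derive x 1 (fun y => f ((y - a) / e)) (e^-1 * df).
Proof.
move=> fdf.
have d1 : is_derive x 1 (fun y => (y - a) / e) (e^-1 : R).
  apply: (@is_derive_quad _ _ _ _ 0) => y.
  by rewrite mul0r (_ : _ - _ = 0) ?normr0//; ring.
by apply: (is_derive_eq (@is_derive1_comp _ f (fun y => (y - a) / e) x _ _ fdf d1)); rewrite mulrC.
Qed.

Let bumpZ (c : R) P n x : bump (c *: P) n x = c * bump P n x.
Proof. by rewrite /bump; case: ifP => _; rewrite ?mulr0// hornerZ !mulrA. Qed.

Let is_derive_bumps (a b e : R) P n (x : R) :
  is_derive x 1 (bumps a b e P n) (bumps a b e (e^-1 *: bump_deriv P n) n.+2 x).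
Proof.
apply: (is_derive_eq (is_deriveB (is_derive_affine (is_derive_bump P n _))
  (is_derive_affine (is_derive_bump P n _)))).
by rewrite /bumps !bumpZ.
Qed.

Lemma is_derive_plateau (a b e x : R) : is_derive x 1 (plateau a b e)
  (e^-1 * bump 1 0 ((x - a) / e) - e^-1 * bump 1 0 ((x - b) / e)).
Proof.
exact: (is_derive_eq (is_deriveB (is_derive_affine (is_derive_smooth_step _))
  (is_derive_affine (is_derive_smooth_step _)))).
Qed.

Section Plateau.
Variables a b e : R.
Hypotheses (e_gt0 : 0 < e) (ab : a + e <= b).

Lemma plateau_out (x : R) : x <= a \/ b + e <= x -> plateau a b e x = 0.
Proof.
have le0 (y c : R) : y <= c -> G ((y - c) / e) = 0.
  by move=> yc; apply: smooth_step_le0; rewrite pmulr_lle0 ?invr_gt0// subr_le0.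
have ge1 (y c : R) : c + e <= y -> G ((y - c) / e) = G 1.
  by move=> yc; apply: smooth_step_ge1; rewrite ler_pdivlMr// mul1r lerBrDl.
have := e_gt0; have := ab; rewrite /plateau => ab' e0 [xa|bx].
  by rewrite !le0 ?subrr//; lra.
by rewrite !ge1 ?subrr//; lra.
Qed.

Lemma plateau_mid (x : R) : a + e <= x <= b -> plateau a b e x = G 1.
Proof.
move=> /andP[ax xb]; rewrite /plateau.
have -> : G ((x - b) / e) = 0.
  by apply: smooth_step_le0; rewrite pmulr_lle0 ?invr_gt0// subr_le0.
rewrite subr0; apply: smooth_step_ge1.
by rewrite ler_pdivlMr// mul1r lerBrDl.
Qed.

Lemma plateau_norm_le (x : R) : `|plateau a b e x| <= G 1.
Proof.
rewrite /plateau; have /andP[h1 h2] := smooth_step_bnd ((x - a) / e).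
have /andP[h3 h4] := smooth_step_bnd ((x - b) / e).
by rewrite ler_norml; lra.
Qed.

(** All derivatives of order at least 1 are differences of two rescaled bumps,
and these differences form a family closed under differentiation. *)
Lemma plateau_test : 0 < a -> b + e < 1 -> test_function (plateau a b e).
Proof.
move=> a0 b1.
have sub : [set x | plateau a b e x != 0] `<=` `[a, b + e]%classic.
  move=> x /= h; rewrite in_itv/=; apply/andP; split; rewrite leNgt; apply/negP => h'.
    by move: h; rewrite plateau_out ?eqxx//; left; exact: ltW.
  by move: h; rewrite plateau_out ?eqxx//; right; exact: ltW.
have csub : closure [set x | plateau a b e x != 0] `<=` `[a, b + e]%classic.
  have /closure_id -> : closed (`[a, b + e]%classic : set R) by exact: interval_closed.
  exact: closureS.
split.
- move=> n x.
  have [df [[P [m ->]]|->] h] : exists2 df : R -> R,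
     (exists P m, df = bumps a b e P m) \/
     df = (fun x => e^-1 * bump 1 0 ((x - a) / e) - e^-1 * bump 1 0 ((x - b) / e))
     & forall y : R, is_derive y 1 (derive1n n (plateau a b e)) (df y).
  + elim: n => [|n [df hdf dn]].
      by eexists; [right; reflexivity|exact: is_derive_plateau].
    rewrite derive1nS (derive1_is_derive dn).
    case: hdf => [[P [m ->]]|->].
      by eexists; [left; do 2 eexists; reflexivity|exact: is_derive_bumps].
    have -> : (fun x => e^-1 * bump 1 0 ((x - a) / e) - e^-1 * bump 1 0 ((x - b) / e)) =
       bumps a b e (e^-1 *: 1) 0.
      by apply/funext => y; rewrite /bumps !bumpZ.
    by eexists; [left; do 2 eexists; reflexivity|exact: is_derive_bumps].
  + by case: (h x).
  + by case: (h x).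
- apply: (@subclosed_compact _ _ `[a, b + e]%classic) => //.
    exact: closed_closure.
  exact: segment_compact.
- move=> x /csub; rewrite /= in_itv/= => /andP[ax xb]; apply/I01E.
  by rewrite (lt_le_trans a0)// (le_lt_trans xb).
Qed.

End Plateau.

(** The derivative of the plateau is a difference of two of these approximate
point masses, of total mass [smooth_step 1], at a and at b. *)
Definition mollifier (a e x : R) : R := e^-1 * bump 1 0 ((x - a) / e).

Lemma mollifier_continuous (a e : R) : continuous (mollifier a e).
Proof.
apply: (@is_derive_continuous _ _
  (fun x => e^-1 * (e^-1 * bump (bump_deriv 1 0) 2 ((x - a) / e)))) => x.
have h := is_derive_affine (is_derive_bump 1 0 ((x - a) / e)).
exact: (@is_deriveZ R R R _ e^-1 x 1 _ h).
Qed.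

Lemma mbounded_mollifier (a e : R) : mbounded (mollifier a e).
Proof. by apply: mbounded_continuous; apply: continuous_subspaceT; exact: mollifier_continuous. Qed.

Lemma itg_mollifier (u : R -> R) (a e eta : R) : 0 < e -> 0 <= a -> a + e <= 1 ->
  mbounded u -> (forall x, a <= x <= a + e -> `|u x - u a| <= eta) ->
  `|itg (fun x => u x * mollifier a e x) 0 1 - u a * G 1| <= eta * G 1.
Proof.
move=> e0 a0 a1 bu hu.
have bm := mbounded_mollifier a e.
have im : itg (mollifier a e) 0 1 = G 1.
  have dG (x : R) : is_derive x 1 (fun x => G ((x - a) / e)) (mollifier a e x).
    exact: is_derive_affine (is_derive_smooth_step _).
  rewrite (itg_FTC dG (@mollifier_continuous a e) ler01).
  rewrite (_ : G ((1 - a) / e) = G 1); last first.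
    by apply: smooth_step_ge1; rewrite ler_pdivlMr//; lra.
  rewrite (_ : G ((0 - a) / e) = 0) ?subr0//.
  by apply: smooth_step_le0; rewrite pmulr_lle0 ?invr_gt0//; lra.
have m0 x : 0 <= mollifier a e x.
  by rewrite mulr_ge0 ?invr_ge0 ?(ltW e0)//; exact: rho_ge0.
have -> : itg (fun x => u x * mollifier a e x) 0 1 - u a * G 1 =
    itg (fun x => (u x - u a) * mollifier a e x) 0 1.
  rewrite -im -itgZ// -itgB//; [|exact: mboundedM|exact: mboundedZ].
  by apply: eq_itg => x _; rewrite mulrBl.
have bd : mbounded (fun x => (u x - u a) * mollifier a e x).
  by apply: mboundedM => //; apply: mboundedB => //; exact: mbounded_cst.
have key x : `|(u x - u a) * mollifier a e x| <= eta * mollifier a e x.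
  have [/andP[x0 x1]|xo] := boolP (0 < (x - a) / e < 1).
    rewrite normrM (ger0_norm (m0 x)) ler_wpM2r// hu//.
    by move: x0 x1; rewrite pmulr_lgt0 ?invr_gt0// ltr_pdivrMr//; lra.
  by rewrite /mollifier bump_out// !mulr0 normr0.
rewrite -im ler_norml -mulNr -!itgZ//; apply/andP; split.
  apply: ler_itg => //; first exact: mboundedZ.
  by move=> x _; have := key x; rewrite ler_norml mulNr => /andP[].
apply: ler_itg => //; first exact: mboundedZ.
by move=> x _; have := key x; rewrite ler_norml => /andP[].
Qed.

(** The plateau differs from [smooth_step 1] times the indicator function only
on the two transitions, each of length e; the third error term comes from the
first transition, which belongs to [a, b]. *)
Lemma itg_plateau (g : R -> R) (a b e M : R) : 0 < e -> 0 <= a -> a + e <= b -> b + e <= 1 ->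
  mbounded g -> (forall x, I01 x -> `|g x| <= M) ->
  `|itg (fun x => g x * plateau a b e x) 0 1 - G 1 * itg g a b| <= 3 * M * G 1 * e.
Proof.
move=> e0 a0 ab b1 bg gM.
have J0 := smooth_step1_gt0.
have cp : continuous (plateau a b e) by exact: is_derive_continuous (is_derive_plateau a b e).
have bp : mbounded (plateau a b e).
  by apply: mbounded_continuous; exact: continuous_subspaceT.
have bgp : mbounded (fun x => g x * plateau a b e x) by exact: mboundedM.
rewrite (@itg_split _ _ 0 a 1)//; [|lra..].
rewrite (@itg_split _ _ a (a + e) 1)//; [|lra..].
rewrite (@itg_split _ _ (a + e) b 1)//; [|lra..].
rewrite (@itg_split _ _ b (b + e) 1)//; [|lra..].
rewrite (@itg_split _ g a (a + e) b)//; [|lra..].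
have -> : itg (fun x => g x * plateau a b e x) 0 a = 0.
  rewrite (@eq_itg _ _ (fun=> 0)) ?itg_cst ?mul0r// => x /andP[_ xa].
  by rewrite plateau_out ?mulr0//; left; exact: ltW.
have -> : itg (fun x => g x * plateau a b e x) (b + e) 1 = 0.
  rewrite (@eq_itg _ _ (fun=> 0)) ?itg_cst ?mul0r// => x /andP[bx _].
  by rewrite plateau_out ?mulr0//; right; exact: ltW.
have -> : itg (fun x => g x * plateau a b e x) (a + e) b = G 1 * itg g (a + e) b.
  rewrite -itgZ//; [|lra|lra]; apply: eq_itg => x /andP[x1 x2].
  by rewrite plateau_mid ?(ltW x1) ?(ltW x2)// mulrC.
have h1 : `|itg (fun x => g x * plateau a b e x) a (a + e)| <= M * G 1 * (a + e - a).
  apply: itg_norm_le => //; [lra|lra|] => x xI.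
  by rewrite normrM ler_pM// ?plateau_norm_le// gM//; apply/I01E; lra.
have h2 : `|itg (fun x => g x * plateau a b e x) b (b + e)| <= M * G 1 * (b + e - b).
  apply: itg_norm_le => //; [lra|lra|] => x xI.
  by rewrite normrM ler_pM// ?plateau_norm_le// gM//; apply/I01E; lra.
have h3 : `|itg g a (a + e)| <= M * (a + e - a).
  by apply: itg_norm_le => //; [lra|lra|] => x xI; rewrite gM//; apply/I01E; lra.
have h4 : `|G 1 * itg g a (a + e)| <= G 1 * (M * (a + e - a)).
  by rewrite normrM gtr0_norm// ler_wpM2l// ltW.
rewrite add0r addr0 mulrDr.
move: h1 h2 h4; rewrite !(addrC a e) !(addrC b e) !addrK.
by rewrite !ler_norml => /andP[? ?] /andP[? ?] /andP[? ?]; lra.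
Qed.

End SmoothStep.

(** * Weak derivatives and increments *)

Section WeakDerivatives.
Variable R : realType.
Implicit Types u v g : R -> R.

Lemma within01_eps u : {within `[0, 1]%classic, continuous u} ->
  forall x e : R, 0 <= x <= 1 -> 0 < e -> exists2 d : R, 0 < d &
    forall y, 0 <= y <= 1 -> `|y - x| <= d -> `|u y - u x| <= e.
Proof.
move=> cu x e xI e0.
have xA : (`[0, 1]%classic : set R) x by rewrite /= in_itv.
have := cu x; rewrite /continuous_at /= => /cvgrPdist_le /(_ e e0).
rewrite /prop_near1 /nbhs /= -nbhs_subspace_in//= /within /= => /nbhs_ballP[d /= d0 H].
exists (d / 2); first by rewrite divr_gt0.
move=> y yI yx; rewrite distrC; apply: H; last by rewrite /= in_itv.
by rewrite /ball/= distrC (le_lt_trans yx)// ltr_pdivrMr// ltr_pMr// ltr1n.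
Qed.

(* Testing against the plateau over [a, b]: as the transitions shrink, the left
   side of the weak equation tends to u a - u b by continuity of u, and the
   right side to minus the integral of v, both times smooth_step 1. *)
Let increment_interior u v g (a b : R) : {within `[0, 1]%classic, continuous u} ->
  weak_derivative u v -> measurable_fun (I01 : set R) v -> mbounded g ->
  ae01 (fun x => v x = g x) -> 0 < a -> a < b -> b < 1 -> u b - u a = itg g a b.
Proof.
move=> cu wuv mv bg vg a0 ab b1.
have bu := mbounded_continuous cu.
have [M M0 gM] : exists2 M : R, 0 <= M & forall x, I01 x -> `|g x| <= M.
  case: bg => _ [M gM]; exists `|M| => // x xI.
  by rewrite (le_trans (gM x xI))// ler_norm.
have J0 := smooth_step1_gt0 R.
set J := smooth_step 1 in J0.
apply/eqP; rewrite -subr_eq0 -normr_le0.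
apply/ler_addgt0Pr => eta' eta'0; rewrite add0r.
pose eta := eta' / (2 + 3 * M).
have M1 : 0 < 2 + 3 * M by lra.
have eta0 : 0 < eta by rewrite divr_gt0.
have [da da0 ha] := within01_eps cu (x := a) (e := eta) ltac:(lra) eta0.
have [db db0 hb] := within01_eps cu (x := b) (e := eta) ltac:(lra) eta0.
pose e := Num.min (Num.min da db) (Num.min (Num.min (b - a) ((1 - b) / 2)) eta).
have e0 : 0 < e.
  by rewrite !lt_min da0 db0 eta0 /= !andbT; apply/andP; split; lra.
have [[ea eb] [[eab e1] eeta]]  :
    (e <= da /\ e <= db) /\ ((e <= b - a /\ e <= (1 - b) / 2) /\ e <= eta).
  by rewrite /e !ge_min !lexx ?orbT.
have test : test_function (plateau a b e) by apply: plateau_test => //; lra.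
have := wuv _ test.
rewrite (derive1_is_derive (is_derive_plateau a b e)).
have ma := mbounded_mollifier a e.
have mb := mbounded_mollifier b e.
have -> : \int[@lebesgue_measure R]_(x in I01) (u x *
    (e^-1 * bump 1 0 ((x - a) / e) - e^-1 * bump 1 0 ((x - b) / e))) =
    itg (fun x => u x * mollifier a e x) 0 1 - itg (fun x => u x * mollifier b e x) 0 1.
  rewrite -itgB//; try exact: mboundedM.
  by apply: eq_itg => x _; rewrite mulrBr.
have cp : continuous (plateau a b e) by exact: is_derive_continuous (is_derive_plateau a b e).
have bp : mbounded (plateau a b e).
  by apply: mbounded_continuous; exact: continuous_subspaceT.
have -> : \int[@lebesgue_measure R]_(x in I01) (v x * plateau a b e x) =
    itg (fun x => g x * plateau a b e x) 0 1.
  apply: ae_eq_itg => //.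
  - by apply: measurable_funM => //; case: bp.
  - by case: (mboundedM bg bp).
  - by apply: ae01W vg => x _ ->.
have ka : `|itg (fun x => u x * mollifier a e x) 0 1 - u a * J| <= eta * J.
  apply: itg_mollifier => //; [lra|lra|] => x /andP[x1 x2].
  by apply: ha; [lra|rewrite ger0_norm; lra].
have kb : `|itg (fun x => u x * mollifier b e x) 0 1 - u b * J| <= eta * J.
  apply: itg_mollifier => //; [lra|lra|] => x /andP[x1 x2].
  by apply: hb; [lra|rewrite ger0_norm; lra].
have kg : `|itg (fun x => g x * plateau a b e x) 0 1 - J * itg g a b| <= 3 * M * J * e.
  by apply: itg_plateau => //; lra.
have ke : 3 * M * J * e <= 3 * M * J * eta.
  by apply: ler_wpM2l => //; rewrite !mulr_ge0// ltW.
move=> hyp.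
have : `|J * (u b - u a - itg g a b)| <= J * ((2 + 3 * M) * eta).
  by move: ka kb kg ke hyp; clear; rewrite !ler_norml => /andP[? ?] /andP[? ?] /andP[? ?] ? ?; lra.
rewrite normrM (gtr0_norm J0) ler_pM2l// => /le_trans -> //.
by rewrite /eta mulrC divfK// gt_eqF.
Qed.

(** A continuous function with a bounded weak derivative is the integral of this
derivative. The endpoints 0 and 1, which no test function reaches, follow from
the continuity of u. *)
Lemma W1oo_increment u v g : W1oo u v -> mbounded g ->
  ae01 (fun x => v x = g x) ->
  forall a b : R, 0 <= a -> a <= b -> b <= 1 -> u b - u a = itg g a b.
Proof.
move=> [Lu Lv wuv cu] bg vg a b a0; rewrite le_eqVlt => /predU1P[->|ab] b1.
  by rewrite itgxx subrr.
have mv := in_Linfty_measurable Lv.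
have [M M0 gM] : exists2 M : R, 0 <= M & forall x, I01 x -> `|g x| <= M.
  case: bg => _ [M gM]; exists `|M| => // x xI.
  by rewrite (le_trans (gM x xI))// ler_norm.
apply/eqP; rewrite -subr_eq0 -normr_le0.
apply/ler_addgt0Pr => eta' eta'0; rewrite add0r.
pose eta := eta' / (2 + 2 * M).
have M1 : 0 < 2 + 2 * M by lra.
have eta0 : 0 < eta by rewrite divr_gt0.
have [da da0 ha] := within01_eps cu (x := a) (e := eta) ltac:(lra) eta0.
have [db db0 hb] := within01_eps cu (x := b) (e := eta) ltac:(lra) eta0.
pose t := Num.min (Num.min da db) (Num.min ((b - a) / 3) eta).
have t0 : 0 < t.
  by rewrite !lt_min da0 db0 eta0 /= !andbT; lra.
have [[ta tb] [tab teta]] : (t <= da /\ t <= db) /\ (t <= (b - a) / 3 /\ t <= eta).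
  by rewrite /t !ge_min !lexx ?orbT.
have ki := @increment_interior u v g (a + t) (b - t) cu wuv mv bg vg
  ltac:(lra) ltac:(lra) ltac:(lra).
have ka := ha (a + t) ltac:(lra) ltac:(rewrite ger0_norm; lra).
have kb := hb (b - t) ltac:(lra) ltac:(rewrite ler0_norm; lra).
rewrite (@itg_split _ _ a (a + t) b)//; [|lra..].
rewrite (@itg_split _ _ (a + t) (b - t) b)//; [|lra..].
have h1 : `|itg g a (a + t)| <= M * (a + t - a).
  by apply: itg_norm_le => //; [lra|lra|] => x xI; rewrite gM//; apply/I01E; lra.
have h2 : `|itg g (b - t) b| <= M * (b - (b - t)).
  by apply: itg_norm_le => //; [lra|lra|] => x xI; rewrite gM//; apply/I01E; lra.
have ht : M * t <= M * eta by rewrite ler_wpM2l.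
have -> : eta' = (2 + 2 * M) * eta by rewrite /eta mulrC divfK// gt_eqF.
by move: ka kb h1 h2 ki; rewrite !ler_norml => /andP[? ?] /andP[? ?] /andP[? ?] /andP[? ?] ?; lra.
Qed.

Lemma lipschitz_within_continuous u (L : R) :
  (forall a b : R, 0 <= a -> a <= b -> b <= 1 -> `|u b - u a| <= L * (b - a)) ->
  {within `[0, 1]%classic, continuous u}.
Proof.
move=> uL; apply/subspace_continuousP => x /= xI.
apply/cvgrPdist_le => e e0; rewrite near_withinE; near=> y => yI.
have L0 : 0 < `|L| + 1 by rewrite ltr_wpDl.
have xy : `|x - y| <= e / (`|L| + 1).
  near: y; apply: cvgr_dist_le; [exact: cvg_id|exact: divr_gt0].
have key (a b : R) : 0 <= a -> a <= b -> b <= 1 -> `|a - b| <= e / (`|L| + 1) ->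
    `|u b - u a| <= e.
  move=> a0 ab b1; rewrite distrC (ger0_norm (_ : 0 <= b - a)) ?subr_ge0//.
  rewrite ler_pdivlMr// => h.
  have := uL a b a0 ab b1.
  have : L * (b - a) <= `|L| * (b - a) by rewrite ler_wpM2r ?subr_ge0// ler_norm.
  have : 0 <= b - a by rewrite subr_ge0.
  lra.
move: xI yI; rewrite !in_itv/= => /andP[x0 x1] /andP[y0 y1].
have [h|/ltW h] := leP x y; last by apply: key => //; rewrite distrC.
by rewrite distrC; apply: key.
Unshelve. all: by end_near. Qed.

(** Integration by parts, for a function u that is only Lipschitz: u phi and the
primitive of u phi' + v phi have the same increments up to a quadratic error,
hence differ by a constant, and phi vanishes at 0 and 1. *)
Lemma increment_W1oo u v : mbounded v ->
  (forall a b : R, 0 <= a -> a <= b -> b <= 1 -> u b - u a = itg v a b) ->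
  W1oo u v.
Proof.
move=> bv uv.
have [M M0 vM] : exists2 M : R, 0 <= M & forall x, I01 x -> `|v x| <= M.
  case: bv => _ [M vM]; exists `|M| => // x xI.
  by rewrite (le_trans (vM x xI))// ler_norm.
have lipu (a b : R) : 0 <= a -> a <= b -> b <= 1 -> `|u b - u a| <= M * (b - a).
  move=> a0 ab b1; rewrite uv//; apply: itg_norm_le => // x xI.
  by apply: vM; apply/I01E; lra.
have cu := lipschitz_within_continuous lipu.
have bu := mbounded_continuous cu.
split; [exact: mbounded_in_Linfty|exact: mbounded_in_Linfty| |exact: cu].
move=> phi [dphi _ sphi].
have d0 (x : R) : is_derive x 1 phi (derive1 phi x).
  by split; [exact: (dphi 0%N)|rewrite derive1E].
have d1 (x : R) : is_derive x 1 (derive1 phi) (derive1 (derive1 phi) x).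
  by split; [exact: (dphi 1%N)|rewrite derive1E].
have cphi := is_derive_continuous d0.
have cdphi := is_derive_continuous d1.
have bphi : mbounded phi by apply: mbounded_continuous; exact: continuous_subspaceT.
have bdphi : mbounded (derive1 phi) by apply: mbounded_continuous; exact: continuous_subspaceT.
have [N HN] : exists N : R, forall x, 0 <= x <= 1 -> `|derive1 phi x| <= N.
  by apply: within_continuous_bounded; exact: continuous_subspaceT.
have N0 : 0 <= N by apply: le_trans (HN 0 _); rewrite ?lexx ?ler01.
have ftc (a b : R) : 0 <= a -> a <= b -> b <= 1 -> phi b - phi a = itg (derive1 phi) a b.
  by move=> _ ab _; rewrite (itg_FTC d0 cdphi ab).
have lipphi (a b : R) : 0 <= a -> a <= b -> b <= 1 -> `|phi b - phi a| <= N * (b - a).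
  move=> a0 ab b1; rewrite ftc//; apply: itg_norm_le => // x xI.
  by apply: HN; lra.
have bw : mbounded (fun x => u x * derive1 phi x + v x * phi x).
  by apply: mboundedD; exact: mboundedM.
pose H x := u x * phi x - itg (fun x => u x * derive1 phi x + v x * phi x) 0 x.
have H01 : H 1 = H 0.
  apply: (@quad_constant _ H (M * N + M * N)); rewrite ?lexx ?ler01// => a b a0 ab b1.
  have -> : H b - H a = itg (fun x => (u b - u x) * derive1 phi x + (phi a - phi x) * v x) a b.
    have b0 := le_trans a0 ab.
    rewrite /H (@itg_split _ _ 0 a b)//.
    have -> : itg (fun x => (u b - u x) * derive1 phi x + (phi a - phi x) * v x) a b =
      u b * itg (derive1 phi) a b + phi a * itg v a b -
      itg (fun x => u x * derive1 phi x + v x * phi x) a b.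
      rewrite -!itgZ// -itgD// -?itgB//; try exact: mboundedZ.
        by apply: eq_itg => x _; ring.
      by apply: mboundedD; exact: mboundedZ.
    by rewrite -uv// -ftc//; ring.
  rewrite [X in _ <= X](_ : _ = (M * N * (b - a) + M * N * (b - a)) * (b - a)); last by ring.
  apply: itg_norm_le => //.
    apply: mboundedD; apply: mboundedM => //; apply: mboundedB => //; exact: mbounded_cst.
  move=> x /andP[ax xb].
  have x0 : 0 <= x by lra.
  have x1 : x <= 1 by lra.
  rewrite (le_trans (ler_normD _ _))// lerD// normrM.
    rewrite mulrAC ler_pM ?HN ?x0 ?x1//.
    rewrite (le_trans (lipu x b x0 (ltW xb) b1))// ler_wpM2l//; lra.
  rewrite [leRHS](_ : _ = N * (b - a) * M); last by ring.
  rewrite ler_pM ?vM//; last by apply/I01E; lra.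
  rewrite distrC (le_trans (lipphi a x a0 (ltW ax) x1))// ler_wpM2l//; lra.
have phi_out x : ~ (I01 : set R) x -> phi x = 0.
  move=> xI; apply/eqP; apply: contrapT => /negP h; apply: xI; apply: sphi.
  exact: subset_closure.
have p0 : phi 0 = 0 by apply: phi_out => /I01E; rewrite ltxx.
have p1 : phi 1 = 0 by apply: phi_out => /I01E; rewrite ltxx andbF.
move: H01; rewrite /H p0 p1 itgxx !mulr0 subr0 sub0r => /eqP.
rewrite oppr_eq0 itgD//; [|exact: mboundedM|exact: mboundedM].
by rewrite addr_eq0 => /eqP.
Qed.

End WeakDerivatives.

(** * Densities of functions with bounded slopes *)

Section Density.
Variable R : realType.
Local Notation mu := (@lebesgue_measure R).

(** Let mu_G be the Lebesgue-Stieltjes measure of G. As x - G x is nondecreasing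
too, it has a measure whose sum with mu_G is the Lebesgue measure, so mu_G is at
most the Lebesgue measure. The Radon-Nikodym theorem gives a density f, and f
is at most 1 almost everywhere, since mu_G would exceed the Lebesgue measure on
the set where f > 1. *)
Lemma unit_density (G : R -> R) :
  (forall x y : R, x <= y -> 0 <= G y - G x <= y - x) ->
  exists2 f : R -> R, mbounded f &
    (forall x, 0 <= f x <= 1) /\
    forall a b : R, 0 <= a -> a <= b -> b <= 1 -> G b - G a = itg f a b.
Proof.
move=> slope.
have cont (H : R -> R) : (forall x y : R, x <= y -> 0 <= H y - H x <= y - x) ->
    right_continuous H.
  move=> Hs; apply: right_continuousW => x; apply/cvgrPdist_le => e e0.
  near=> y.
  have xy : `|x - y| <= e by near: y; apply: cvgr_dist_le; [exact: cvg_id|].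
  apply: le_trans xy; have [h|/ltW h] := leP x y.
    have /andP[h1 h2] := Hs _ _ h; rewrite [leLHS]distrC [leRHS]distrC.
    by rewrite !ger0_norm// subr_ge0.
  have := Hs _ _ h => /andP[h1 h2].
  by rewrite !ger0_norm// subr_ge0.
pose H x := x - G x.
have Hslope x y : x <= y -> 0 <= H y - H x <= y - x.
  by move=> xy; rewrite /H; have := slope x y xy; lra.
have ndG : nondecreasing G by move=> x y xy; have := slope x y xy; lra.
have ndH : nondecreasing H by move=> x y xy; have := Hslope x y xy; lra.
pose G' : cumulative R R := HB.pack G (isCumulative.Build R _ R G ndG (cont _ slope)).
pose H' : cumulative R R := HB.pack H (isCumulative.Build R _ R H ndH (cont _ Hslope)).
pose mG := lebesgue_stieltjes_measure G'.
pose mH := lebesgue_stieltjes_measure H'.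
have LS (K : cumulative R R) a b :
    (lebesgue_stieltjes_measure K `]a, b]%classic = wlength K `]a, b]%classic)%E.
  rewrite /lebesgue_stieltjes_measure/= /measure_extension/=.
  by rewrite measurable_mu_extE//; exact: is_ocitv.
(* both sides agree on half-open intervals *)
have sum A : measurable A -> (mu A = mG A + mH A)%E.
  move=> mA; rewrite (@lebesgue_measure_unique _ (measure_add mG mH))//; first exact: measure_addE.
  move=> _ [[a b] _ <-] /=; rewrite [RHS]measure_addE.
  transitivity (wlength G' `]a, b]%classic + wlength H' `]a, b]%classic)%E; last first.
    by congr (_ + _)%E; exact/esym/LS.
  transitivity (wlength (@idfun R) `]a, b]%classic)%E; first exact: LS.
  rewrite !wlength_itv/=; case: ifP => _; last by rewrite adde0.
  by rewrite -!EFinD /H; congr EFin; ring.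
have mGle A : measurable A -> (mG A <= mu A)%E.
  by move=> mA; rewrite sum// leeDl// measure_ge0.
have mI : measurable (`]0, 1]%classic : set R) by exact: measurable_itv.
(* restricting to ]0, 1] makes the measure finite *)
pose nu0 := mrestr mG mI.
have finnu : fin_num_fun nu0.
  move=> U mU; rewrite ge0_fin_numE ?measure_ge0//.
  apply: (@le_lt_trans _ _ (mG `]0%R, 1%R]%classic)).
    by rewrite /nu0 /mrestr; apply: le_measure; rewrite ?inE//; exact: measurableI.
  by rewrite /mG LS wlength_itv/= lte_fin ltr01 -EFinB ltry.
pose nu : {finite_measure set (measurableTypeR R) -> \bar R} :=
  HB.pack nu0 (Measure_isFinite.Build _ _ _ nu0 finnu).
have nule A : measurable A -> (nu A <= mu A)%E.
  move=> mA; apply: le_trans (mGle A mA).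
  by rewrite /nu /= /nu0 /mrestr le_measure// ?inE//; exact: measurableI.
have numu : nu `<< mu.
  apply/null_content_dominatesP => A mA A0; apply/eqP.
  by rewrite -measure_le0; apply: (le_trans (nule A mA)); rewrite [leLHS]A0.
have [f0 [f0_ge0 f0_fin fint0 fE0]] := radon_nikodym_sigma_finite numu.
pose f x := fine (f0 x).
have f0E : f0 = EFin \o f by apply/funext => x; rewrite /= fineK.
have fge0 x : 0 <= f x by rewrite fine_ge0.
rewrite f0E in fint0 fE0.
have mf : measurable_fun [set: R] f.
  by apply/measurable_EFinP; exact: (measurable_int mu fint0).
(* the set where the density exceeds 1 is negligible *)
pose D := `]0, 1]%classic `&` [set x | 1 < f x].
have mD : measurable D.
  have -> : D = `]0, 1]%classic `&` [set x | (1%:E < (f x)%:E)%E].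
    by apply/seteqP; split => x [xI /= fx]; split; rewrite //= ?lte_fin// -lte_fin.
  apply: (@emeasurable_fun_o_infty _ _ _ _ (EFin \o f)) => //.
  by apply/measurable_EFinP; exact: measurable_funTS.
have muD : (mu D < +oo)%E.
  apply: (@le_lt_trans _ _ (mu `]0%R, 1%R]%classic)).
    by apply: le_measure; rewrite ?inE//; exact: subIsetl.
  by rewrite lebesgue_measure_itv/= lte_fin ltr01 -EFinB ltry.
have intD : (\int[mu]_(x in D) (f x)%:E <= mu D)%E.
  by rewrite -fE0//; exact: nule.
have int1 : mu.-integrable D (EFin \o cst 1).
  apply: measurable_bounded_integrable => //; exact: bounded_cst.
have i1 : (\int[mu]_(x in D) (EFin \o cst 1%R) x = mu D)%E.
  by rewrite -[RHS]mul1e -(integral_cst mu mD).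
have intfD : mu.-integrable D (EFin \o f) by exact: integrableS fint0.
have ae1 : ae_eq mu D (EFin \o (fun x => f x - 1)) (cst 0%E).
  have mfD : measurable_fun D (EFin \o (fun x => f x - 1)).
    apply/measurable_EFinP; apply: measurable_funB; last exact: measurable_cst.
    exact: measurable_funTS.
  apply/(ae_eq_integral_abs mu mD mfD).
  have fD x : D x -> 0 <= f x - 1 by move=> [_ /= fx]; rewrite subr_ge0 ltW.
  rewrite (eq_integral (EFin \o (fun x => f x - 1))); last first.
    by move=> x /set_mem Dx; rewrite gee0_abs//= lee_fin fD.
  apply/eqP; rewrite eq_le; apply/andP; split; last first.
    by apply: integral_ge0 => x Dx; rewrite lee_fin fD.
  rewrite (@integralB_EFin _ _ _ mu D f (cst 1) mD intfD int1) i1.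
  by rewrite -(subee (_ : mu D \is a fin_num)) ?leeB// ge0_fin_numE ?measure_ge0.
have mg : measurable_fun [set: R] (fun x => Num.min 1 (f x)).
  by apply: measurable_minr => //; exact: measurable_cst.
have g01 x : 0 <= Num.min 1 (f x) <= 1.
  by rewrite ge_min lexx/= andbT le_min ler01/= fge0.
exists (fun x => Num.min 1 (f x)).
  split; first exact: measurable_funTS.
  by exists 1 => x _; rewrite ger0_norm; have /andP[] := g01 x.
split => // a b a0 ab b1.
have sub : (`]a, b]%classic : set R) `<=` `]0, 1]%classic.
  by move=> x /=; rewrite !in_itv/= => /andP[h1 h2]; rewrite (le_lt_trans a0)// (le_trans h2).
have nuab : nu `]a, b]%classic = (G b - G a)%:E.
  rewrite /nu /= /nu0 /mrestr setIidl// /mG LS wlength_itv/= lte_fin.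
  case: ltP => [_|ba]; first by rewrite -EFinB.
  by rewrite (_ : a = b) ?subrr//; apply/eqP; rewrite eq_le ab ba.
rewrite /itg /Rintegral -[LHS]/(fine (G b - G a)%:E) -nuab fE0//; congr fine.
rewrite -integral_itv_bndo_bndc; last first.
  by apply/measurable_EFinP; exact: measurable_funTS.
apply: ae_eq_integral => //.
- by apply/measurable_EFinP; exact: measurable_funTS.
- by apply/measurable_EFinP; exact: measurable_funTS.
have FF : Filter (almost_everywhere mu) by exact: ae_filter_ringOfSetsType.
apply: (@filterS _ _ FF _ _ _ ae1) => x H1 xab.
have xI : (`]0, 1]%classic : set R) x.
  by apply: sub; move: xab; rewrite /= !in_itv/= => /andP[-> /ltW].
have f1 : f x <= 1.
  rewrite leNgt; apply/negP => fx; have [] := H1 (conj xI fx).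
  by move/eqP; rewrite subr_eq0 => /eqP fx1; rewrite fx1 ltxx in fx.
by rewrite /= min_r.
Unshelve. all: by end_near. Qed.

(** Reduction to slopes between 0 and 1 by an affine change of F. The clamp c
extends F from [0, 1] to the whole line. *)
Lemma slope_density (b1 b2 : R) (F : R -> R) : b1 <= b2 ->
  (forall a b : R, 0 <= a -> a <= b -> b <= 1 ->
    b1 * (b - a) <= F b - F a <= b2 * (b - a)) ->
  exists2 B : R -> R, mbounded B &
    (forall x, b1 <= B x <= b2) /\
    forall a b : R, 0 <= a -> a <= b -> b <= 1 -> F b - F a = itg B a b.
Proof.
(* for b1 = b2 the rescaling would divide by 0, and B is constant *)
rewrite le_eqVlt => /predU1P[->|b12] slope.
  exists (fun=> b2); first exact: mbounded_cst.
  split=> [x|a b a0 ab lb1]; first by rewrite lexx.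
  by rewrite itg_cst//; apply/eqP; rewrite eq_le andbC slope.
pose k := b2 - b1; have k0 : 0 < k by rewrite subr_gt0.
pose c x : R := Num.max 0 (Num.min 1 x).
have cI (x : R) : 0 <= x -> x <= 1 -> c x = x by move=> x0 x1; rewrite /c min_r// max_r.
have c01 (x : R) : 0 <= c x <= 1 by rewrite /c le_max lexx/= ge_max ler01/= ge_min lexx.
have cnd (x y : R) : x <= y -> 0 <= c y - c x <= y - x.
  move=> xy; rewrite /c; have [x1|x1] := leP 1 x; have [y1|y1] := leP 1 y.
  - by rewrite subrr lexx subr_ge0.
  - lra.
  - have [x0|x0] := leP 0 x; rewrite (max_r ler01); lra.
  - have [x0|x0] := leP 0 x; have [y0|y0] := leP 0 y; lra.
have [x y xy|f bf [f01 fE]] := @unit_density (fun x => k^-1 * (F (c x) - b1 * c x)).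
  have /andP[x0 x1] := c01 x; have /andP[y0 y1] := c01 y.
  have /andP[h1 h2] := cnd x y xy.
  have cxy : c x <= c y by rewrite -subr_ge0.
  have /andP[i1 i2] := slope _ _ x0 cxy y1.
  rewrite -mulrBr pmulr_rge0 ?invr_gt0// ler_pdivrMl//.
  apply/andP; split; first lra.
  have : k * (c y - c x) <= k * (y - x) by rewrite ler_wpM2l// ltW.
  rewrite /k; lra.
exists (fun x => b1 + k * f x).
  by apply: mboundedD; [exact: mbounded_cst|exact: mboundedZ].
split=> [x|a b a0 ab lb1].
  have /andP[h1 h2] := f01 x; apply/andP; split.
    by rewrite lerDl mulr_ge0// ltW.
  by have : k * f x <= k * 1 by [rewrite ler_wpM2l// ltW]; rewrite /k; lra.
have b0 := le_trans a0 ab; have a1 := le_trans ab lb1.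
rewrite itgD//; [|exact: mbounded_cst|exact: mboundedZ].
rewrite itg_cst// itgZ// -fE// !cI// -mulrBr mulVKf ?gt_eqF//; ring.
Qed.

End Density.

(** * Quasi-eigenvalues and the string equation *)

(** The equation y'' + kappa^2 B y = 0 in integral form, with the notation of
[string_sol]: p' = r, q' = s and r' + i s' = - kappa^2 B y. *)
Record string_int (R : realType) (al be : R) (B p q r s : R -> R) : Prop :=
    StringInt {
  si_p : forall a b : R, 0 <= a -> a <= b -> b <= 1 -> p b - p a = itg r a b;
  si_q : forall a b : R, 0 <= a -> a <= b -> b <= 1 -> q b - q a = itg s a b;
  si_r : forall a b : R, 0 <= a -> a <= b -> b <= 1 -> r b - r a =
    itg (fun x => (- (al ^+ 2 - be ^+ 2) * p x + 2 * al * be * q x) * B x) a b;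
  si_s : forall a b : R, 0 <= a -> a <= b -> b <= 1 -> s b - s a =
    itg (fun x => (- (2 * al * be) * p x + - (al ^+ 2 - be ^+ 2) * q x) * B x) a b;
  si_cont : [/\ {within `[0, 1]%classic, continuous p},
                {within `[0, 1]%classic, continuous q},
                {within `[0, 1]%classic, continuous r} &
                {within `[0, 1]%classic, continuous s}];
  si_left : r 0 = 0 /\ s 0 = 0;
  si_right : al * p 1 - be * q 1 = - s 1 /\ al * q 1 + be * p 1 = r 1 }.

Section Freeze.
Variable R : realType.

(** Replacing the Lipschitz coefficients g0 and g1 by their values at the left
endpoint costs one factor b - a beyond the length of the interval. *)
Lemma itg_freeze (g0 g1 B : R -> R) (K0 K1 M a b : R) :
  mbounded g0 -> mbounded g1 -> mbounded B ->
  (forall x, I01 x -> `|B x| <= M) -> 0 <= K0 -> 0 <= K1 ->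
  (forall x y : R, 0 <= x -> x <= y -> y <= 1 -> `|g0 y - g0 x| <= K0 * (y - x)) ->
  (forall x y : R, 0 <= x -> x <= y -> y <= 1 -> `|g1 y - g1 x| <= K1 * (y - x)) ->
  0 <= a -> a <= b -> b <= 1 ->
  `|itg (fun x => g0 x + g1 x * B x) a b -
    (g0 a * (b - a) + g1 a * itg B a b)| <= (K0 + K1 * M) * (b - a) ^+ 2.
Proof.
move=> bg0 bg1 bB BM K00 K10 lip0 lip1 a0 ab b1.
have bb : mbounded (fun x => g0 x + g1 x * B x).
  by apply: mboundedD => //; exact: mboundedM.
have -> : itg (fun x => g0 x + g1 x * B x) a b - (g0 a * (b - a) + g1 a * itg B a b) =
    itg (fun x => (g0 x + g1 x * B x) - (g0 a + g1 a * B x)) a b.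
  have bc : mbounded (fun x => g0 a + g1 a * B x).
    by apply: mboundedD; [exact: mbounded_cst|exact: mboundedZ].
  rewrite itgB//; congr (_ - _).
  rewrite itgD//; [|exact: mbounded_cst|exact: mboundedZ].
  by rewrite itg_cst// itgZ.
rewrite expr2 mulrA; apply: itg_norm_le => //.
  apply: mboundedB => //.
  by apply: mboundedD; [exact: mbounded_cst|exact: mboundedZ].
move=> x /andP[ax xb]; have xI : I01 x by apply/I01E; lra.
have x1 : x <= 1 by lra.
have -> : g0 x + g1 x * B x - (g0 a + g1 a * B x) =
    (g0 x - g0 a) + (g1 x - g1 a) * B x by ring.
rewrite (le_trans (ler_normD _ _))// [leRHS]mulrDl lerD//.
  rewrite (le_trans (lip0 a x a0 (ltW ax) x1))// ler_wpM2l//; lra.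
rewrite normrM [leRHS]mulrAC ler_pM// ?BM//.
rewrite (le_trans (lip1 a x a0 (ltW ax) x1))// ler_wpM2l//; lra.
Qed.

(** A function with differential g0 dx + g1 dF is an integral: by [itg_freeze]
its difference with the integral has quadratic increments. *)
Lemma quad_diff_integral (F B f g0 g1 : R -> R) (K M : R) :
  mbounded B -> (forall x, I01 x -> `|B x| <= M) -> 0 <= K ->
  (forall a b : R, 0 <= a -> a <= b -> b <= 1 -> F b - F a = itg B a b) ->
  (forall x y : R, 0 <= x -> x <= y -> y <= 1 -> `|g0 y - g0 x| <= K * (y - x)) ->
  (forall x y : R, 0 <= x -> x <= y -> y <= 1 -> `|g1 y - g1 x| <= K * (y - x)) ->
  quad_diff F f g0 g1 ->
  forall a b : R, 0 <= a -> a <= b -> b <= 1 ->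
    f b - f a = itg (fun x => g0 x + g1 x * B x) a b.
Proof.
move=> bB BM K0 FB lip0 lip1 [_ _ _ [C HC]].
have b0 := mbounded_continuous (lipschitz_within_continuous lip0).
have b1 := mbounded_continuous (lipschitz_within_continuous lip1).
have bb : mbounded (fun x => g0 x + g1 x * B x).
  by apply: mboundedD => //; exact: mboundedM.
pose H x := f x - itg (fun x => g0 x + g1 x * B x) 0 x.
have HH (a b : R) : 0 <= a -> a <= b -> b <= 1 -> H b = H a.
  apply: (@quad_constant _ H (C + (K + K * M))) => {}a {}b a0 ab lb1.
  have hE : H b - H a = (f b - f a) - itg (fun x => g0 x + g1 x * B x) a b.
    by rewrite /H (@itg_split _ _ 0 a b)//; ring.
  have h1 := HC a b a0 ab lb1.
  have h2 := itg_freeze b0 b1 bB BM K0 K0 lip0 lip1 a0 ab lb1.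
  rewrite hE mulrDl; move: h1 h2; rewrite FB// !ler_norml => /andP[? ?] /andP[? ?].
  by lra.
move=> a b a0 ab lb1; have := HH a b a0 ab lb1.
by rewrite /H (@itg_split _ _ 0 a b)//; lra.
Qed.

End Freeze.

Section Translation.
Variable R : realType.
Implicit Types (B F p q r s : R -> R) (al be c rho C : R).

(** B is first clamped to [b1, b2], which changes it on a null set only. *)
Lemma quasi_eigenvalue_string_int (b1 b2 : R) B (k : R[i]) : 0 <= b1 -> b1 <= b2 ->
  Ad b1 b2 B -> quasi_eigenvalue B k ->
  exists B' p q r s : R -> R,
  [/\ mbounded B', forall x, b1 <= B' x <= b2,
    string_int (complex.Re k) (complex.Im k) B' p q r s &
    exists2 x : R, 0 <= x <= 1 & (p x != 0) || (q x != 0)].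
Proof.
move=> b10 b12 [LB aeB] [k0 [y [dy [d2y [[[yr yi] [dyr dyi]] [x xI yx] ode dy0 bc]]]]].
pose B' x := Num.max b1 (Num.min b2 (B x)).
have B'I t : b1 <= B' t <= b2 by rewrite /B' le_max lexx/= ge_max b12/= ge_min lexx.
have mB' : measurable_fun (I01 : set R) B'.
  apply: measurable_maxr; first exact: measurable_cst.
  by apply: measurable_minr; [exact: measurable_cst|exact: in_Linfty_measurable].
have bB' : mbounded B'.
  split => //; exists b2 => z _; have /andP[h1 h2] := B'I z.
  by rewrite ger0_norm// (le_trans b10).
have aeB' : ae01 (fun z => B z = B' z).
  by apply: ae01W aeB => z _ /andP[h1 h2]; rewrite /B' min_r// max_r.
have [[_ _ _ cp] [_ _ _ cq]] := (yr, yi).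
have [[_ _ _ cr] [_ _ _ cs]] := (dyr, dyi).
have br := mbounded_continuous cr; have bs := mbounded_continuous cs.
have bp := mbounded_continuous cp; have bq := mbounded_continuous cq.
have ae0 (f : R -> R) : ae01 (fun z => f z = f z).
  by apply: ae01W aeB => z _ _.
exists B', (fun z => complex.Re (y z)), (fun z => complex.Im (y z)),
  (fun z => complex.Re (dy z)), (fun z => complex.Im (dy z)).
split => //; last first.
  exists x; first by move: xI; rewrite /= in_itv.
  by move: yx; case: (y x) => u v; rewrite eq_complex /= negb_and.
have ode2 : ae01 (fun z =>
   complex.Re (d2y z) = (- (complex.Re k ^+ 2 - complex.Im k ^+ 2) * complex.Re (y z) +
      2 * complex.Re k * complex.Im k * complex.Im (y z)) * B' z /\
   complex.Im (d2y z) = (- (2 * complex.Re k * complex.Im k) * complex.Re (y z) +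
      - (complex.Re k ^+ 2 - complex.Im k ^+ 2) * complex.Im (y z)) * B' z).
  apply: ae01W (ae01I ode aeB') => z _ [h <-]; move: h.
  case: (d2y z) (y z) k {k0 bc ode} => [u v] [m n] [al be].
  rewrite expr2; simpc => -[h1 h2]; split; apply/eqP; rewrite -subr_eq0; apply/eqP.
    by rewrite -[RHS]h1 /=; ring.
  by rewrite -[RHS]h2 /=; ring.
split => //=.
- by move=> a b; apply: (W1oo_increment yr br (ae0 _)).
- by move=> a b; apply: (W1oo_increment yi bs (ae0 _)).
- move=> a b; apply: (W1oo_increment dyr); last by apply: ae01W ode2 => z _ [].
  by apply: mboundedM => //; apply: mboundedD; exact: mboundedZ.
- move=> a b; apply: (W1oo_increment dyi); last by apply: ae01W ode2 => z _ [].
  by apply: mboundedM => //; apply: mboundedD; exact: mboundedZ.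
- by rewrite dy0.
- have : k * y 1 = 'i%C * dy 1.
    by move/eqP: bc; rewrite subr_eq0 => /eqP ->; rewrite mulrC divfK.
  case: k (y 1) (dy 1) {k0 bc ode ode2} => [al be] [m n] [u v].
  by simpc => -[-> ->]; split; rewrite /=; ring.
Qed.

Lemma string_int_quasi_eigenvalue B p q r s al be : mbounded B ->
  string_int al be B p q r s -> (al != 0) || (be != 0) ->
  (exists2 x : R, 0 <= x <= 1 & (p x != 0) || (q x != 0)) ->
  quasi_eigenvalue B (al +i* be).
Proof.
move=> bB S k0 [x xI nz]; have [cp cq cr cs] := si_cont S.
have br := mbounded_continuous cr; have bs := mbounded_continuous cs.
have bp := mbounded_continuous cp; have bq := mbounded_continuous cq.
have kn : al +i* be != 0 by rewrite eq_complex /= negb_and.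
split=> //.
exists (fun z => p z +i* q z), (fun z => r z +i* s z), (fun z =>
  ((- (al ^+ 2 - be ^+ 2) * p z + 2 * al * be * q z) * B z) +i*
  ((- (2 * al * be) * p z + - (al ^+ 2 - be ^+ 2) * q z) * B z)).
split.
- split; split => /=; apply: increment_W1oo => //.
  + exact: (si_p S).
  + exact: (si_q S).
  + by apply: mboundedM => //; apply: mboundedD; exact: mboundedZ.
  + exact: (si_r S).
  + by apply: mboundedM => //; apply: mboundedD; exact: mboundedZ.
  + exact: (si_s S).
- exists x; first by rewrite /= in_itv.
  by rewrite eq_complex /= negb_and.
- have FF : Filter (almost_everywhere (@lebesgue_measure R)) by exact: ae_filter_ringOfSetsType.
  apply: (@filterE _ _ FF) => z _; rewrite expr2; simpc.
  by apply/eqP; rewrite eq_complex /=; apply/andP; split; apply/eqP; ring.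
- by have [-> ->] := si_left S.
- apply/eqP; rewrite subr_eq0; apply/eqP; apply: (mulfI kn).
  rewrite [RHS]mulrC divfK//; have [h1 h2] := si_right S.
  by apply/eqP; rewrite eq_complex /=; apply/andP; split; apply/eqP; move: h1 h2; lra.
Qed.

Lemma string_intZ B p q r s al be c : mbounded B -> string_int al be B p q r s ->
  string_int al be B (fun x => c * p x) (fun x => c * q x) (fun x => c * r x)
    (fun x => c * s x).
Proof.
move=> bB S; have [cp cq cr cs] := si_cont S.
have br := mbounded_continuous cr; have bs := mbounded_continuous cs.
have bp := mbounded_continuous cp; have bq := mbounded_continuous cq.
have cZ (f : R -> R) : {within `[0, 1]%classic, continuous f} ->
    {within `[0, 1]%classic, continuous (fun x => c * f x)}.
  by move=> cf x; apply: continuousM; [exact: cst_continuous|exact: cf].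
split.
- by move=> a b a0 ab b1; rewrite -mulrBr (si_p S)// itgZ.
- by move=> a b a0 ab b1; rewrite -mulrBr (si_q S)// itgZ.
- move=> a b a0 ab b1; rewrite -mulrBr (si_r S)// -itgZ//.
    by apply: eq_itg => x _; ring.
  by apply: mboundedM => //; apply: mboundedD; exact: mboundedZ.
- move=> a b a0 ab b1; rewrite -mulrBr (si_s S)// -itgZ//.
    by apply: eq_itg => x _; ring.
  by apply: mboundedM => //; apply: mboundedD; exact: mboundedZ.
- by split; exact: cZ.
- by have [-> ->] := si_left S; rewrite mulr0.
- have [h1 h2] := si_right S; split => /=; last by rewrite -h2; ring.
  rewrite (_ : - (c * s 1) = c * - s 1); last by ring.
  by rewrite -h1; ring.
Qed.

(** The maximum of |y| is scaled to 1, so that all estimates on the solution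
become estimates in terms of kappa and b2. *)
Lemma string_int_normalize B p q r s al be : mbounded B ->
  string_int al be B p q r s ->
  (exists2 x : R, 0 <= x <= 1 & (p x != 0) || (q x != 0)) ->
  exists p' q' r' s' : R -> R, string_int al be B p' q' r' s' /\
    exists2 x0 : R, 0 <= x0 <= 1 & p' x0 ^+ 2 + q' x0 ^+ 2 = 1 /\
      forall x : R, 0 <= x <= 1 -> p' x ^+ 2 + q' x ^+ 2 <= 1.
Proof.
move=> bB S [x xI nz]; have [cp cq _ _] := si_cont S.
have [x0 x0I hmax] : exists2 c, c \in `[0, 1]%R & forall t, t \in `[0, 1]%R ->
    p t ^+ 2 + q t ^+ 2 <= p c ^+ 2 + q c ^+ 2.
  have cpq : {within `[0, 1]%classic, continuous (fun t => p t * p t + q t * q t)}.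
    have cM (f : R -> R) : {within `[0, 1]%classic, continuous f} ->
        {within `[0, 1]%classic, continuous (fun x => f x * f x)}.
      by move=> cf z; apply: continuousM; exact: cf.
    have -> : (fun t => p t * p t + q t * q t) =
      (fun t => p t * p t) + (fun t => q t * q t) :> (R -> R) by [].
    by move=> z; apply: continuousD _ _; [exact: (cM p)|exact: (cM q)].
  exact: (EVT_max ler01 cpq).
rewrite in_itv/= in x0I.
pose m := p x0 ^+ 2 + q x0 ^+ 2.
have m0 : 0 < m.
  have := hmax x; rewrite in_itv/= => /(_ xI); apply: lt_le_trans.
  have := sqr_ge0 (p x); have := sqr_ge0 (q x) => hq hp.
  case/orP: nz => nz.
    by rewrite ltr_pwDl// lt0r sqrf_eq0 nz.
  by rewrite ltr_wpDl// lt0r sqrf_eq0 nz.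
pose c := (Num.sqrt m)^-1.
have cm : c ^+ 2 * m = 1.
  by rewrite /c exprVn sqr_sqrtr ?ltW// mulVf// gt_eqF.
exists (fun x => c * p x), (fun x => c * q x), (fun x => c * r x), (fun x => c * s x).
split; first exact: string_intZ.
exists x0 => //; split=> [|t tI]; first by rewrite !exprMn -mulrDr.
by rewrite !exprMn -mulrDr -cm ler_wpM2l ?sqr_ge0// hmax// in_itv.
Qed.

(** With |y| <= 1 the equation bounds y' by L = 2 |kappa|^2 b2, since y'(0) = 0;
this yields the uniform constant. The second part keeps kappa away from 0. At a
point x0 with |y(x0)| = 1 one has |y(x0) - y(1)| of order L, and the boundary
condition gives |kappa|^2 |y(1)|^2 = |y'(1)|^2 <= 2 L^2, so that |kappa| cannot
be too small. *)
Lemma string_int_sol (b1 b2 : R) B p q r s al be rho : (al != 0) || (be != 0) ->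
  0 <= b1 -> b1 <= b2 ->
  mbounded B -> (forall x, b1 <= B x <= b2) -> string_int al be B p q r s ->
  (forall x : R, 0 <= x <= 1 -> p x ^+ 2 + q x ^+ 2 <= 1) ->
  al ^+ 2 + be ^+ 2 <= rho ->
  string_sol b1 b2 al be (1 + 2 * rho * b2 + (2 * rho * b2) ^+ 2) (itg B 0) p q r s /\
  ((exists2 x0 : R, 0 <= x0 <= 1 & p x0 ^+ 2 + q x0 ^+ 2 = 1) ->
   1 <= 16 * b2 ^+ 2 * ((al ^+ 2 + be ^+ 2) * (1 + (al ^+ 2 + be ^+ 2)))).
Proof.
move=> k0 b10 b12 bB BI S pq1 Nrho; have [cp cq cr cs] := si_cont S.
have br := mbounded_continuous cr; have bs := mbounded_continuous cs.
have bp := mbounded_continuous cp; have bq := mbounded_continuous cq.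
have b20 : 0 <= b2 by exact: le_trans b12.
pose N := al ^+ 2 + be ^+ 2.
have N0 : 0 <= N by rewrite addr_ge0// sqr_ge0.
have AN : `|al ^+ 2 - be ^+ 2| <= N.
  by rewrite ler_norml /N; have := sqr_ge0 al; have := sqr_ge0 be; lra.
have DN : `|2 * al * be| <= N.
  by rewrite ler_norml /N; have := sqr_ge0 (al + be); have := sqr_ge0 (al - be); lra.
have sq1 (u v : R) : u ^+ 2 + v ^+ 2 <= 1 -> `|u| <= 1.
  move=> uv; rewrite -(@ler_pXn2r _ 2)// ?nnegrE// expr1n real_normK ?num_real//.
  by have := sqr_ge0 v; lra.
have p1 (x : R) : 0 <= x <= 1 -> `|p x| <= 1 by move=> /pq1; exact: sq1.
have q1 (x : R) : 0 <= x <= 1 -> `|q x| <= 1.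
  by move=> /pq1; rewrite addrC; exact: sq1.
have BM x : (I01 : set R) x -> `|B x| <= b2.
  by move=> _; have /andP[h1 h2] := BI x; rewrite ger0_norm// (le_trans b10).
have comb (c d u v t : R) : `|c| <= N -> `|d| <= N -> `|u| <= t -> `|v| <= t ->
    `|c * u + d * v| <= 2 * N * t.
  move=> cN dN ut vt; rewrite (le_trans (ler_normD _ _))// !normrM.
  rewrite (_ : 2 * N * t = N * t + N * t); last by ring.
  by rewrite lerD// ler_pM.
pose L := 2 * N * b2.
have L0 : 0 <= L by rewrite !mulr_ge0.
have AN' : `|- (al ^+ 2 - be ^+ 2)| <= N by rewrite normrN.
have DN' : `|- (2 * al * be)| <= N by rewrite normrN.
have lipr (a b : R) : 0 <= a -> a <= b -> b <= 1 -> `|r b - r a| <= L * (b - a).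
  move=> a0 ab lb1; rewrite (si_r S)//; apply: itg_norm_le => //.
    by apply: mboundedM => //; apply: mboundedD; exact: mboundedZ.
  move=> x xI; have xI' : 0 <= x <= 1 by lra.
  have := comb _ _ _ _ 1 AN' DN (p1 x xI') (q1 x xI'); rewrite mulr1 => h.
  by rewrite normrM ler_pM// BM//; apply/I01E; lra.
have lips (a b : R) : 0 <= a -> a <= b -> b <= 1 -> `|s b - s a| <= L * (b - a).
  move=> a0 ab lb1; rewrite (si_s S)//; apply: itg_norm_le => //.
    by apply: mboundedM => //; apply: mboundedD; exact: mboundedZ.
  move=> x xI; have xI' : 0 <= x <= 1 by lra.
  have := comb _ _ _ _ 1 DN' AN' (p1 x xI') (q1 x xI'); rewrite mulr1 => h.
  by rewrite normrM ler_pM// BM//; apply/I01E; lra.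
have [r0 s0] := si_left S.
have rL (x : R) : 0 <= x <= 1 -> `|r x| <= L.
  move=> /andP[x0 x1]; have := lipr 0 x (lexx 0) x0 x1; rewrite r0 !subr0 => /le_trans.
  by apply; rewrite ler_piMr.
have sL (x : R) : 0 <= x <= 1 -> `|s x| <= L.
  move=> /andP[x0 x1]; have := lips 0 x (lexx 0) x0 x1; rewrite s0 !subr0 => /le_trans.
  by apply; rewrite ler_piMr.
have lipp (a b : R) : 0 <= a -> a <= b -> b <= 1 -> `|p b - p a| <= L * (b - a).
  move=> a0 ab lb1; rewrite (si_p S)//; apply: itg_norm_le => // x xI.
  by apply: rL; lra.
have lipq (a b : R) : 0 <= a -> a <= b -> b <= 1 -> `|q b - q a| <= L * (b - a).
  move=> a0 ab lb1; rewrite (si_q S)//; apply: itg_norm_le => // x xI.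
  by apply: sL; lra.
have lip0 (a b : R) : 0 <= a -> a <= b -> b <= 1 -> `|0 - 0 : R| <= 0 * (b - a).
  by move=> *; rewrite subrr normr0 mul0r.
pose L' := 2 * rho * b2.
have LL' : L <= L' by rewrite /L /L' ler_wpM2r// ler_wpM2l.
have L'0 : 0 <= L' by exact: le_trans LL'.
have LL2 : L ^+ 2 <= L' ^+ 2 by apply: lerXn2r.
have sq (h c : R) : c <= 1 + L' + L' ^+ 2 -> c * h ^+ 2 <= (1 + L' + L' ^+ 2) * h ^+ 2.
  by move=> ?; rewrite ler_wpM2r// sqr_ge0.
have sqL := sqr_ge0 L'.
have itgF (a b : R) : 0 <= a -> a <= b -> b <= 1 -> itg B 0 b - itg B 0 a = itg B a b.
  by move=> a0 ab lb1; rewrite (@itg_split _ B 0 a b)// addrAC subrr add0r.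
split; last first.
  move=> [x0 x0I unit]; have /andP[x00 x01] := x0I.
  have hp := lipp x0 1 x00 x01 (lexx 1).
  have hq := lipq x0 1 x00 x01 (lexx 1).
  have I1 : 0 <= (1 : R) <= 1 by rewrite ler01 lexx.
  have hp' : `|p 1 - p x0| <= L by apply: le_trans hp _; rewrite ler_piMr//; lra.
  have hq' : `|q 1 - q x0| <= L by apply: le_trans hq _; rewrite ler_piMr//; lra.
  have sqn (u t : R) : `|u| <= t -> u ^+ 2 <= t ^+ 2.
    by move=> ut; rewrite -(real_normK (num_real u)); apply: lerXn2r; rewrite ?nnegrE// (le_trans _ ut).
  have i1 := sqn _ _ hp'; have i2 := sqn _ _ hq'.
  have i3 := sqn _ _ (rL 1 I1); have i4 := sqn _ _ (sL 1 I1).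
  have [e1 e2] := si_right S.
  have e3 : N * (p 1 ^+ 2 + q 1 ^+ 2) = r 1 ^+ 2 + s 1 ^+ 2.
    by rewrite -e2 -[s 1]opprK -e1 /N; ring.
  have N1 : 0 < N.
    case/orP: k0 => k0.
      by rewrite /N ltr_pwDl ?sqr_ge0// lt0r sqrf_eq0 k0 sqr_ge0.
    by rewrite /N ltr_pwDr ?sqr_ge0// lt0r sqrf_eq0 k0 sqr_ge0.
  have i5 : p 1 ^+ 2 + q 1 ^+ 2 <= 8 * N * b2 ^+ 2.
    rewrite -(ler_pM2l N1) e3.
    have : L ^+ 2 = 4 * N * N * b2 ^+ 2 by rewrite /L; ring.
    by move=> LE; rewrite LE in i3 i4; lra.
  have i6 : p x0 ^+ 2 <= 2 * p 1 ^+ 2 + 2 * (p 1 - p x0) ^+ 2.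
    by have := sqr_ge0 (2 * p 1 - p x0); lra.
  have i7 : q x0 ^+ 2 <= 2 * q 1 ^+ 2 + 2 * (q 1 - q x0) ^+ 2.
    by have := sqr_ge0 (2 * q 1 - q x0); lra.
  have LE : L ^+ 2 = 4 * N * N * b2 ^+ 2 by rewrite /L; ring.
  rewrite LE in i1 i2.
  rewrite -/N (_ : 16 * b2 ^+ 2 * (N * (1 + N)) =
    16 * (N * b2 ^+ 2) + 16 * (N * N * b2 ^+ 2)); last by ring.
  lra.
split.
- move=> a b a0 ab lb1; rewrite itgF//; apply/andP; split.
    rewrite -itg_cst//; apply: ler_itg => //; first exact: mbounded_cst.
    by move=> x _; have /andP[] := BI x.
  rewrite -itg_cst//; apply: ler_itg => //; first exact: mbounded_cst.
  by move=> x _; have /andP[] := BI x.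
- move=> a b a0 ab lb1; rewrite (si_p S)//.
  have := itg_freeze br (mbounded_cst 0) bB BM L0 (lexx 0) lipr lip0 a0 ab lb1.
  rewrite !mul0r !addr0.
  rewrite (_ : (fun x => _) = r) => [h|]; last by apply/funext => x; rewrite mul0r addr0.
  by apply: le_trans h _; apply: sq; lra.
- move=> a b a0 ab lb1; rewrite (si_q S)//.
  have := itg_freeze bs (mbounded_cst 0) bB BM L0 (lexx 0) lips lip0 a0 ab lb1.
  rewrite !mul0r !addr0.
  rewrite (_ : (fun x => _) = s) => [h|]; last by apply/funext => x; rewrite mul0r addr0.
  by apply: le_trans h _; apply: sq; lra.
- move=> a b a0 ab lb1; rewrite (si_r S)//.
  pose g x := - (al ^+ 2 - be ^+ 2) * p x + 2 * al * be * q x.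
  have bg : mbounded g by apply: mboundedD; exact: mboundedZ.
  have lipg (x y : R) : 0 <= x -> x <= y -> y <= 1 -> `|g y - g x| <= 2 * N * L * (y - x).
    move=> x0 xy y1; rewrite /g.
    rewrite (_ : _ - _ = - (al ^+ 2 - be ^+ 2) * (p y - p x) +
      2 * al * be * (q y - q x)); last by ring.
    by rewrite -[leRHS]mulrA comb//; [exact: lipp|exact: lipq].
  have NL0 : 0 <= 2 * N * L by rewrite !mulr_ge0.
  have := itg_freeze (mbounded_cst 0) bg bB BM (lexx 0) NL0 lip0 lipg a0 ab lb1.
  rewrite !mul0r !add0r (_ : 2 * N * L * b2 = L ^+ 2); last by rewrite /L; ring.
  rewrite (_ : (fun x => _ + _) = (fun x => g x * B x)) => [h|];
    last by apply/funext => x; rewrite add0r.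
  rewrite itgF//; apply: le_trans (sq _ _ _); last first.
    by apply: (_ : L ^+ 2 <= _); lra.
  apply: le_trans h; rewrite le_eqVlt; apply/orP; left; apply/eqP.
  by congr `|_|; rewrite /g; ring.
- move=> a b a0 ab lb1; rewrite (si_s S)//.
  pose g x := - (2 * al * be) * p x + - (al ^+ 2 - be ^+ 2) * q x.
  have bg : mbounded g by apply: mboundedD; exact: mboundedZ.
  have lipg (x y : R) : 0 <= x -> x <= y -> y <= 1 -> `|g y - g x| <= 2 * N * L * (y - x).
    move=> x0 xy y1; rewrite /g.
    rewrite (_ : _ - _ = - (2 * al * be) * (p y - p x) +
      - (al ^+ 2 - be ^+ 2) * (q y - q x)); last by ring.
    by rewrite -[leRHS]mulrA comb//; [exact: lipp|exact: lipq].
  have NL0 : 0 <= 2 * N * L by rewrite !mulr_ge0.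
  have := itg_freeze (mbounded_cst 0) bg bB BM (lexx 0) NL0 lip0 lipg a0 ab lb1.
  rewrite !mul0r !add0r (_ : 2 * N * L * b2 = L ^+ 2); last by rewrite /L; ring.
  rewrite (_ : (fun x => _ + _) = (fun x => g x * B x)) => [h|];
    last by apply/funext => x; rewrite add0r.
  rewrite itgF//; apply: le_trans (sq _ _ _); last first.
    by apply: (_ : L ^+ 2 <= _); lra.
  apply: le_trans h; rewrite le_eqVlt; apply/orP; left; apply/eqP.
  by congr `|_|; rewrite /g; ring.
- move=> x xI; rewrite -/L'; split.
  + by apply: le_trans (p1 x xI) _; lra.
  + by apply: le_trans (q1 x xI) _; lra.
  + by apply: le_trans (rL x xI) _; lra.
  + by apply: le_trans (sL x xI) _; lra.
- exact: (si_left S).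
- exact: (si_right S).
Qed.

Lemma string_sol_int (b1 b2 : R) B F p q r s al be C : 0 <= b1 -> b1 <= b2 ->
  mbounded B -> (forall x, b1 <= B x <= b2) ->
  (forall a b : R, 0 <= a -> a <= b -> b <= 1 -> F b - F a = itg B a b) ->
  string_sol b1 b2 al be C F p q r s -> string_int al be B p q r s.
Proof.
move=> b10 b12 bB BI FB S.
have BM x : (I01 : set R) x -> `|B x| <= b2.
  by move=> _; have /andP[h1 h2] := BI x; rewrite ger0_norm// (le_trans b10).
have slope := string_sol_slope b10 S.
have dp := string_sol_diff_p S; have dq := string_sol_diff_q S.
have dr := string_sol_diff_r S; have ds := string_sol_diff_s S.
have [Kp Kp0 lipp] := quad_diff_lipschitz slope dp.
have [Kq Kq0 lipq] := quad_diff_lipschitz slope dq.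
have [Kr Kr0 lipr] := quad_diff_lipschitz slope dr.
have [Ks Ks0 lips] := quad_diff_lipschitz slope ds.
have lip0 (K a b : R) : 0 <= K -> 0 <= a -> a <= b -> b <= 1 -> `|0 - 0 : R| <= K * (b - a).
  by move=> *; rewrite subrr normr0 mulr_ge0// subr_ge0.
have lipc (c d : R) (a b : R) : 0 <= a -> a <= b -> b <= 1 ->
    `|(c * p b + d * q b) - (c * p a + d * q a)| <= (`|c| * Kp + `|d| * Kq) * (b - a).
  move=> a0 ab lb1.
  rewrite (_ : _ - _ = c * (p b - p a) + d * (q b - q a)); last by ring.
  rewrite (le_trans (ler_normD _ _))// mulrDl -!mulrA lerD// normrM ler_wpM2l//.
    exact: lipp.
  exact: lipq.
have Kc0 (c d : R) : 0 <= `|c| * Kp + `|d| * Kq by rewrite addr_ge0// mulr_ge0.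
split.
- move=> a b a0 ab lb1.
  rewrite (quad_diff_integral bB BM Kr0 FB lipr (fun a b => @lip0 Kr a b Kr0) dp)//.
  by apply: eq_itg => x _; rewrite mul0r addr0.
- move=> a b a0 ab lb1.
  rewrite (quad_diff_integral bB BM Ks0 FB lips (fun a b => @lip0 Ks a b Ks0) dq)//.
  by apply: eq_itg => x _; rewrite mul0r addr0.
- move=> a b a0 ab lb1.
  rewrite (quad_diff_integral bB BM (Kc0 _ _) FB (fun a b => @lip0 _ a b (Kc0 _ _)) (lipc _ _) dr)//.
  by apply: eq_itg => x _; rewrite add0r.
- move=> a b a0 ab lb1.
  rewrite (quad_diff_integral bB BM (Kc0 _ _) FB (fun a b => @lip0 _ a b (Kc0 _ _)) (lipc _ _) ds)//.
  by apply: eq_itg => x _; rewrite add0r.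
- by split; apply: lipschitz_within_continuous; eassumption.
- exact: (ss_left S).
- exact: (ss_right S).
Qed.

End Translation.

(** * The set of quasi-eigenvalues *)

Section Assembly.
Variables (R : realType) (b1 b2 : R).
Hypotheses (b1_ge0 : 0 <= b1) (b12 : b1 <= b2).

Let sqn (k : R[i]) : R := complex.Re k ^+ 2 + complex.Im k ^+ 2.
Let bound (rho : R) : R := 1 + 2 * rho * b2 + (2 * rho * b2) ^+ 2.

Lemma complex_neq0 (k : R[i]) : k != 0 ->
  (complex.Re k != 0) || (complex.Im k != 0).
Proof. by case: k => al be; rewrite eq_complex /= negb_and. Qed.

Lemma KAd_string_sol (rho : R) (k : R[i]) : KAd b1 b2 k -> sqn k <= rho ->
  exists (F p q r s : R -> R) (x0 : R),
  [/\ string_sol b1 b2 (complex.Re k) (complex.Im k) (bound rho) F p q r s,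
      F 0 = 0, 0 <= x0 <= 1, p x0 ^+ 2 + q x0 ^+ 2 = 1 &
      1 <= 16 * b2 ^+ 2 * (sqn k * (1 + sqn k))].
Proof.
move=> [B adB Bk] krho; have [k0 _] := Bk.
have [B' [p [q [r [s [bB BI S nz]]]]]] := quasi_eigenvalue_string_int b1_ge0 b12 adB Bk.
have [p' [q' [r' [s' [S' [x0 x0I [unit le1]]]]]]] := string_int_normalize bB S nz.
have [sol low] := string_int_sol (complex_neq0 k0) b1_ge0 b12 bB BI S' le1 krho.
exists (itg B' 0), p', q', r', s', x0; split => //; first exact: itgxx.
by apply: low; exists x0.
Qed.

Lemma string_sol_KAd (al be C : R) (F p q r s : R -> R) :
  string_sol b1 b2 al be C F p q r s -> (al != 0) || (be != 0) ->
  (exists2 x : R, 0 <= x <= 1 & p x ^+ 2 + q x ^+ 2 = 1) ->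
  KAd b1 b2 (al +i* be).
Proof.
move=> S k0 [x xI unit].
have [B bB [BI FB]] := slope_density b12 (ss_F S).
exists B.
  split; first exact: mbounded_in_Linfty.
  have FF : Filter (almost_everywhere (@lebesgue_measure R)) by exact: ae_filter_ringOfSetsType.
  by apply: (@filterE _ _ FF) => z _.
apply: (string_int_quasi_eigenvalue bB _ k0 (p := p) (q := q)).
  exact: string_sol_int S.
exists x => //; apply: contraTT isT; rewrite negb_or !negbK => /andP[/eqP px /eqP qx].
by move: unit; rewrite px qx expr0n addr0 => /eqP; rewrite eq_sym oner_eq0.
Qed.

Lemma KAd_sub_Cplus : KAd b1 b2 `<=` (Cplus : set R[i]).
Proof.
move=> k kK; have [B _ [k0 _]] := kK.
have [F [p [q [r [s [x0 [S _ x0I unit _]]]]]]] := KAd_string_sol kK (lexx _).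
apply: (string_sol_Im_gt0 b1_ge0 b12 S (complex_neq0 k0)); exists x0 => //.
apply: contraTT isT; rewrite negb_or !negbK => /andP[/eqP px /eqP qx].
by move: unit; rewrite px qx expr0n addr0 => /eqP; rewrite eq_sym oner_eq0.
Qed.

Lemma Re_Im_continuous (k : R[i]^o) :
  (@complex.Re R @ nbhs (k : R[i]^o) --> complex.Re k) /\
  (@complex.Im R @ nbhs (k : R[i]^o) --> complex.Im k).
Proof.
have FF := nbhs_filter (k : R[i]^o).
have key (e : R) : 0 < e -> \forall z \near (k : R[i]^o),
    `|complex.Re k - complex.Re z| <= e /\ `|complex.Im k - complex.Im z| <= e.
  move=> e0; apply/nbhs_ballP; exists e%:C => /=; first by rewrite ltcR.
  move=> z; rewrite /ball /= normc_def ltcR.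
  have -> : complex.Re (k - z) = complex.Re k - complex.Re z.
    by case: (k) => ? ?; case: z => ? ?.
  have -> : complex.Im (k - z) = complex.Im k - complex.Im z.
    by case: (k) => ? ?; case: z => ? ?.
  move=> /ltW h.
  by split; apply: le_trans h; rewrite -sqrtr_sqr ler_wsqrtr// ?lerDl ?lerDr sqr_ge0.
by split; apply/(@cvgrPdist_le _ _ _ _ FF) => e e0; apply: (@filterS _ _ FF _ _ _ (key e e0)) => z [].
Qed.

(** An ultrafilter finer than the trace on the set of the neighbourhoods of k
makes normalized solutions converge pointwise. The lower bound on |kappa|
passes to the limit and excludes k = 0, and the coefficient of the limit problem
is the density of the limit of the primitives. *)
Lemma KAd_closed : closed (KAd b1 b2 : set R[i]^o).
Proof.
move=> k kcl.
pose W := within (KAd b1 b2 : set R[i]^o) (nbhs (k : R[i]^o)).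
have PW : ProperFilter W by exact: within_nbhs_proper.
have [G [UG WG]] := ultraFilterLemma PW.
have PG : ProperFilter G by exact: ultra_proper.
have GK : \forall z \near G, KAd b1 b2 z.
  by apply: WG; rewrite /W /within /=; apply: filterE.
have nG : nbhs (k : R[i]^o) `<=` G.
  by move=> A kA; apply: WG; apply: filterS kA => z.
have [cRe cIm] := Re_Im_continuous k.
have cal : complex.Re z @[z --> G] --> complex.Re k.
  by apply: cvg_trans cRe => A /nG.
have cbe : complex.Im z @[z --> G] --> complex.Im k.
  by apply: cvg_trans cIm => A /nG.
pose rho := sqn k + 1.
have csq : sqn z @[z --> G] --> sqn k.
  by apply: cvgD; apply: cvgM.
have Grho : \forall z \near G, sqn z <= rho.
  by apply: (cvgr_le _ csq); rewrite /rho ltrDl.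
pose data := ((R -> R) * (R -> R) * (R -> R) * (R -> R) * (R -> R) * R)%type.
pose good (z : R[i]) (t : data) := let: (F, p, q, r, s, x0) := t in
  [/\ string_sol b1 b2 (complex.Re z) (complex.Im z) (bound rho) F p q r s,
      F 0 = 0, 0 <= x0 <= 1, p x0 ^+ 2 + q x0 ^+ 2 = 1 &
      1 <= 16 * b2 ^+ 2 * (sqn z * (1 + sqn z))].
have /choice[d Hd] : forall z, exists t, KAd b1 b2 z -> sqn z <= rho -> good z t.
  move=> z; have [zK|nz] := pselect (KAd b1 b2 z /\ sqn z <= rho); last first.
    by exists (idfun, idfun, idfun, idfun, idfun, 0) => h1 h2; exfalso; apply: nz.
  have [F [p [q [r [s [x0 H]]]]]] := KAd_string_sol zK.1 zK.2.
  by exists (F, p, q, r, s, x0).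
pose F z := (d z).1.1.1.1.1; pose p z := (d z).1.1.1.1.2; pose q z := (d z).1.1.1.2.
pose r z := (d z).1.1.2; pose s z := (d z).1.2; pose x0 z := (d z).2.
have HG : \forall z \near G,
  [/\ string_sol b1 b2 (complex.Re z) (complex.Im z) (bound rho) (F z) (p z) (q z) (r z) (s z),
      F z 0 = 0, 0 <= x0 z <= 1, p z (x0 z) ^+ 2 + q z (x0 z) ^+ 2 = 1 &
      1 <= 16 * b2 ^+ 2 * (sqn z * (1 + sqn z))].
  apply: filterS2 GK Grho => z zK zr; have := Hd z zK zr.
  by rewrite /good /F /p /q /r /s /x0; case: (d z) => [[[[[? ?] ?] ?] ?] ?].
have sol : \forall z \near G, string_sol b1 b2 (complex.Re z) (complex.Im z) (bound rho)
    (F z) (p z) (q z) (r z) (s z).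
  by apply: filterS HG => z [].
have F0 : \forall z \near G, F z 0 = 0 by apply: filterS HG => z [].
have x01 : \forall z \near G, 0 <= x0 z <= 1 by apply: filterS HG => z [].
have unit : \forall z \near G, p z (x0 z) ^+ 2 + q z (x0 z) ^+ 2 = 1 by apply: filterS HG => z [].
have low : 1 <= 16 * b2 ^+ 2 * (sqn k * (1 + sqn k)).
  have c : 16 * b2 ^+ 2 * (sqn z * (1 + sqn z)) @[z --> G] -->
      16 * b2 ^+ 2 * (sqn k * (1 + sqn k)).
    apply: cvgM; first exact: cvg_cst.
    by apply: cvgM => //; apply: cvgD => //; exact: cvg_cst.
  by apply: (cvgr_to_ge c); apply: filterS HG => z [].
have k0 : (complex.Re k != 0) || (complex.Im k != 0).
  apply: contraTT low; rewrite negb_or !negbK /sqn => /andP[/eqP -> /eqP ->].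
  by rewrite expr0n addr0 mul0r mulr0 -ltNge ltr01.
have S := string_sol_limit UG b1_ge0 b12 cal cbe sol F0.
have U := string_sol_limit_unit UG sol x01 unit.
by rewrite (_ : k = complex.Re k +i* complex.Im k); [exact: string_sol_KAd S k0 U|case: (k)].
Qed.

End Assembly.

Theorem proposition2p1 (R : realType) (b1 b2 : R) :
  0 <= b1 -> b1 <= b2 -> 0 < b2 ->
  closed (KAd b1 b2 : set R[i]^o) /\ KAd b1 b2 `<=` Cplus.
Proof.
by move=> b10 b12 _; split; [exact: KAd_closed|exact: KAd_sub_Cplus].
Qed.
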